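(* Let $n\ge2$ and let $\Gamma\subset\mathrm{PSL}(2,\mathbb{C})$ be a Kleinian, purely loxodromic group freely generated by $\xi_1,\dots,\xi_n$. Let $\Gamma_*=\{1\}\cup\{\xi_i^{t}: 1\le i\le n,\ t=\pm1\}\cup\{\xi_i^t\xi_j^s\xi_i^{-t}: i\ne j,\ t,s=\pm1\}$, and let $\alpha_n$ be the unique root greater than $(2n-1)^2$ of the polynomial $\mathcal{P}$ below. Then for every $z\in\mathbb{H}^3$, $$\max\{d_\gamma z:\gamma\in\Gamma_*\}\ge\tfrac12\log\alpha_n.$$
   Context: For an isometry $\gamma$ of hyperbolic 3-space $\mathbb{H}^3$ (with hyperbolic metric $\rho$) and $z\in\mathbb{H}^3$, $d_\gamma z=\rho(z,\gamma z)$. The polynomial is $\mathcal{P}(\lambda)=(8n^3-12n^2+2n+1)\lambda^4+(-64n^6+192n^5-192n^4+64n^3+4n^2+2n-4)\lambda^3+(-96n^5+224n^4-168n^3+52n^2-18n+6)\lambda^2+(32n^5-112n^4+128n^3-68n^2+22n-4)\lambda+16n^4-32n^3+24n^2-8n+1.$ *)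

(* Defs.v *)
From HB Require Import structures.
From mathcomp Require Import all_boot all_order all_algebra.
From mathcomp Require Import complex.
From mathcomp Require Import reals exp.
Set Implicit Arguments. Unset Strict Implicit. Unset Printing Implicit Defensive.
Import Order.TTheory GRing.Theory Num.Theory.
Local Open Scope ring_scope.

Section Hyp.
Variable R : realType.
Local Notation C := (R[i]).

Definition csq (z : C) : R := (complex.Re z) ^+ 2 + (complex.Im z) ^+ 2.
Definition cconj (z : C) : C := Complex (complex.Re z) (- complex.Im z).

(* Upper half-space model of H^3: points (z, t), z : C, t : R, t > 0. *)
(* Action of g = [[a,b],[c,d]] in SL(2,C) on z + t j (Beardon's formula). *)
Definition mob_act (g : 'M[C]_2) (p : C * R) : C * R :=
  let a := g 0 0 in let b := g 0 1 in let c := g 1 0 in let d := g 1 1 in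
  let z := p.1 in let t := p.2 in
  let D := csq (c * z + d) + csq c * t ^+ 2 in
  ( ((a * z + b) * cconj (c * z + d) + a * cconj c * Complex (t ^+ 2) 0) / Complex D 0,
    t / D ).

(* hyperbolic distance: cosh rho = 1 + (|z-w|^2 + (t-s)^2)/(2 t s),
   rho = arcosh(A) = ln (A + sqrt (A^2 - 1)) *)
Definition hcosh (p q : C * R) : R :=
  1 + (csq (p.1 - q.1) + (p.2 - q.2) ^+ 2) / (2 * p.2 * q.2).
Definition hdist (p q : C * R) : R :=
  let A := hcosh p q in ln (A + Num.sqrt (A ^+ 2 - 1)).

Definition disp (g : 'M[C]_2) (p : C * R) : R := hdist p (mob_act g p).

Variable n : nat.
Variable xi : 'I_n -> 'M[C]_2.

Definition gen (i : 'I_n) (t : bool) : 'M[C]_2 := if t then xi i else invmx (xi i).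

Definition word_eval (w : seq ('I_n * bool)) : 'M[C]_2 :=
  \prod_(x <- w) gen x.1 x.2.

Definition reduced (w : seq ('I_n * bool)) : bool :=
  sorted (fun x y => ~~ ((x.1 == y.1) && (x.2 != y.2))) w.

(* elements of Gamma (as matrices; in PSL(2,C) they are taken up to sign) *)
Definition in_Gamma (g : 'M[C]_2) : Prop := exists w, g = word_eval w.

Definition is_pm1 (g : 'M[C]_2) : Prop := g = 1 \/ g = - 1.

Definition freely_generating : Prop :=
  forall w, reduced w -> w != [::] -> ~ is_pm1 (word_eval w).

Definition mxnsq (g : 'M[C]_2) : R := \sum_(i < 2) \sum_(j < 2) csq (g i j).

(* Kleinian = discrete subgroup of PSL(2,C): the identity is isolated *)
Definition kleinian : Prop :=
  exists eps : R, 0 < eps /\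
    forall g, in_Gamma g -> (mxnsq (g - 1) < eps \/ mxnsq (g + 1) < eps) ->
      is_pm1 g.

Definition loxodromic (g : 'M[C]_2) : Prop :=
  ~ (complex.Im (\tr g) = 0 /\ -2 <= complex.Re (\tr g) <= 2).

Definition purely_loxodromic : Prop :=
  forall g, in_Gamma g -> ~ is_pm1 g -> loxodromic g.

Definition in_Gamma_star (g : 'M[C]_2) : Prop :=
  g = 1 \/ (exists i t, g = gen i t) \/
  (exists i j t s, i != j /\ g = gen i t * gen j s * gen i (~~ t)).

End Hyp.

Definition calP (R : realType) (n : nat) (l : R) : R :=
  let n := (n%:R : R) in
  (8 * n ^+ 3 - 12 * n ^+ 2 + 2 * n + 1) * l ^+ 4
  + (- 64 * n ^+ 6 + 192 * n ^+ 5 - 192 * n ^+ 4 + 64 * n ^+ 3 + 4 * n ^+ 2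
     + 2 * n - 4) * l ^+ 3
  + (- 96 * n ^+ 5 + 224 * n ^+ 4 - 168 * n ^+ 3 + 52 * n ^+ 2 - 18 * n + 6)
    * l ^+ 2
  + (32 * n ^+ 5 - 112 * n ^+ 4 + 128 * n ^+ 3 - 68 * n ^+ 2 + 22 * n - 4) * l
  + (16 * n ^+ 4 - 32 * n ^+ 3 + 24 * n ^+ 2 - 8 * n + 1).

(* Main.v *)
Require Import Defs.
From HB Require Import structures.
From mathcomp Require Import all_boot all_order all_algebra.
From mathcomp Require Import complex finmap.
From mathcomp Require Import all_classical all_reals all_analysis.
From mathcomp Require Import measurable_realfun.
From mathcomp Require Import ring lra.
Set Implicit Arguments. Unset Strict Implicit. Unset Printing Implicit Defensive.
Import Order.TTheory GRing.Theory Num.Theory.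
Import numFieldNormedType.Exports.
Local Open Scope ring_scope.
Local Open Scope classical_set_scope.

(* For every ordered pair consisting of a letter x = xi_i^t and an index j <> i put
   y = xi_j, and let A, B be the sets of reduced words starting with x y, resp.
   x y^-1; left multiplication by x y x^-1 maps B onto the complement of A.  Assign to
   each point of H^3 the (finite, nonempty) set of group elements carrying the base
   point p almost nearest to it, and let phi_A, phi_B be the proportions of its elements
   in A, B; this assignment is equivariant, so phi_A(gamma z) = 1 - phi_B(z) for
   gamma = x y x^-1.  Integrate against the measures m_p with density cosh(rho(p, .))^-s
   for s > 2: with q = gamma^-1 p, the masses of phi_A and phi_B under m_p add up to at
   least the mass of min(m_p, m_q).  As s decreases to 2 the normalised m_p tends to the
   visual measure from p, and the common mass of two visual measures at distance d tends
   to 2 / (1 + e^d).  The 2n(n-1) pairs A, B are disjoint, hence some gamma satisfies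
   e^d >= 4n(n-1) - 1, which is more than the square root of any root of the polynomial. *)

(** * The action of SL(2,C) on the upper half-space *)

(** The inequality for a pair is a change of variables: applying gamma turns the integral of phi_A
    against m_p into that of 1 - phi_B against m_q, and (1 - phi_B) m_q + phi_B m_p is pointwise a
    convex combination of two densities, hence at least their minimum. Everything takes place inside
    H^3, with volume densities instead of measures on the sphere at infinity, so no limit set or
    boundary measure has to be built; the price is an arbitrarily small loss. The exponent 2 is
    critical because balls of radius r have volume of order e^(2r). Spreading the weight of a point
    evenly over all almost nearest elements gives equivariance and measurability without any
    tie-breaking. If d is the largest displacement, each of the 2n(n-1) pairs carries at least 2 /
    (1 + e^d) of a total mass 1; this is where 4n(n-1) - 1 comes from. It suffices because alpha_n
    grows only like 8 n^3, while the square of this constant grows like 16 n^4. *)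

Lemma ord2P (i : 'I_2) : i = 0 \/ i = 1.
Proof. by case: i => [[|[|]]] // h; [left | right]; apply/val_inj. Qed.

Section TwoByTwo.
Variable K : comUnitRingType.

Definition mx2 (a b c d : K) : 'M[K]_2 :=
  \matrix_(i, j) (if i == 0 then if j == 0 then a else b
                  else if j == 0 then c else d).

Lemma mx2E a b c d :
  (mx2 a b c d 0 0 = a) * (mx2 a b c d 0 1 = b) *
  (mx2 a b c d 1 0 = c) * (mx2 a b c d 1 1 = d).
Proof. by rewrite !mxE. Qed.

Lemma mx2_eta (g : 'M[K]_2) : g = mx2 (g 0 0) (g 0 1) (g 1 0) (g 1 1).
Proof.
by apply/matrixP => i j; rewrite mxE; case: (ord2P i) => ->; case: (ord2P j) => ->.
Qed.

Lemma mulmx2 a b c d a' b' c' d' : mx2 a b c d * mx2 a' b' c' d' =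
  mx2 (a * a' + b * c') (a * b' + b * d') (c * a' + d * c') (c * b' + d * d').
Proof.
apply/matrixP => i j; rewrite mxE !big_ord_recl big_ord0 !mxE /= addr0.
by case: (ord2P i) => ->; case: (ord2P j) => ->.
Qed.

Lemma det_mx2 a b c d : \det (mx2 a b c d) = a * d - b * c.
Proof.
rewrite (expand_det_row _ ord0) !big_ord_recl big_ord0 /cofactor !det_mx11 !mxE /=.
rewrite expr0 expr1; ring.
Qed.

Lemma det1_mx2 (g : 'M[K]_2) : \det g = 1 ->
  g 0 0 * g 1 1 - g 0 1 * g 1 0 = 1.
Proof. by rewrite {1}(mx2_eta g) det_mx2. Qed.

Lemma invmx2 a b c d : a * d - b * c = 1 ->
  invmx (mx2 a b c d) = mx2 d (- b) (- c) a.
Proof.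
move=> h; have gu : mx2 a b c d \in unitmx by rewrite unitmxE det_mx2 h unitr1.
rewrite -[RHS](mulKmx gu) (_ : _ *m mx2 d _ _ _ = 1%:M) ?mulmx1 //.
rewrite -[_ *m _]/(_ * _) mulmx2; apply/matrixP => i j; rewrite !mxE.
case: (ord2P i) => ->; case: (ord2P j) => -> /=; rewrite -?h; ring.
Qed.

Definition upper (b : K) := mx2 1 b 0 1.
Definition flip := mx2 0 (-1) 1 0.

End TwoByTwo.

Section SL2Generation.
Variable K : fieldType.

(** An induction principle: SL(2) is generated, even as a monoid, by the unipotents [upper b] and
    [flip]. Composition, isometry and invariance of volume then need checking only for translations
    and one inversion. *)
Lemma SL2_gen (P : 'M[K]_2 -> Prop) :
    (forall b, P (upper b)) -> P (flip K) ->
    (forall g h, P g -> P h -> P (g * h)) ->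
  forall g, \det g = 1 -> P g.
Proof.
move=> Pu Pf PM.
have Pc a b c d : c != 0 -> a * d - b * c = 1 -> P (mx2 a b c d).
  (* The cube of [flip] is its inverse, so the middle factor is the lower unipotent with entry [c];
     the outer unipotents produce [a] and [d], and [b] follows from the determinant. *)
  move=> c0 h; have -> : mx2 a b c d = upper ((a - 1) / c) *
      (flip K * upper (- c) * (flip K * flip K * flip K)) * upper ((d - 1) / c).
    have hb : b = (a * d - 1) / c by apply: (mulIf c0); rewrite mulfVK // -h; ring.
    rewrite hb !mulmx2; congr mx2; field => //.
  have Pf2 := PM _ _ Pf Pf; have Pf3 := PM _ _ Pf2 Pf.
  exact: PM _ _ (PM _ _ (Pu _) (PM _ _ (PM _ _ Pf (Pu _)) Pf3)) (Pu _).
move=> g; rewrite (mx2_eta g) det_mx2.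
move: (g 0 0) (g 0 1) (g 1 0) (g 1 1) => a b c d h.
have [c0|/Pc] := eqVneq c 0; last exact.
have d0 : d != 0.
  by apply/eqP => d0; move/eqP: h; rewrite c0 d0 !mulr0 subrr eq_sym oner_eq0.
(* When [c] vanishes, the matrix splits into two factors whose lower left entries, [d] and -1, are
   nonzero. *)
have -> : mx2 a b c d = mx2 (a + b) b d d * mx2 1 0 (-1) 1.
  by rewrite mulmx2 c0; congr mx2; ring.
apply: PM; apply: Pc => //; rewrite ?oppr_eq0 ?oner_eq0 //; last by ring.
by rewrite -h c0; ring.
Qed.
End SL2Generation.

Section HalfSpace.
Variable R : realType.
Local Notation C := R[i].
Implicit Types (p q : C * R) (b z w : C) (g h : 'M[C]_2).

Definition translate b p : C * R := (p.1 + b, p.2).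

(* Inversion in the unit hemisphere composed with z |-> - conj z. *)
Definition flip_act p : C * R :=
  let N := csq p.1 + p.2 ^+ 2 in
  (Complex (- complex.Re p.1 / N) (complex.Im p.1 / N), p.2 / N).

Lemma complex_eqP z w :
  complex.Re z = complex.Re w -> complex.Im z = complex.Im w -> z = w.
Proof. by case: z w => [? ?] [? ?] /= -> ->. Qed.

Lemma csqE z : Complex (csq z) 0 = z * cconj z.
Proof. by case: z => x y; congr Complex; rewrite /csq /=; ring. Qed.

Lemma csqM z w : csq (z * w) = csq z * csq w.
Proof. by case: z w => [x y] [u v]; rewrite /csq /=; ring. Qed.

Lemma csq_ge0 z : 0 <= csq z.
Proof. by rewrite addr_ge0 ?sqr_ge0. Qed.

Lemma csq_gt0 z : (0 < csq z) = (z != 0).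
Proof.
case: z => x y; rewrite /csq eq_complex /= lt0r addr_ge0 ?sqr_ge0 // andbT.
by rewrite paddr_eq0 ?sqr_ge0 // !sqrf_eq0.
Qed.

Lemma mob_den_gt0 (c d z : C) (t : R) : 0 < t -> (c != 0) || (d != 0) ->
  0 < csq (c * z + d) + csq c * t ^+ 2.
Proof.
move=> t0 /orP[c0|d0].
  by rewrite ltr_wpDl ?csq_ge0 // mulr_gt0 ?csq_gt0 ?exprn_gt0.
have [->|c0] := eqVneq c 0.
  rewrite mul0r add0r [csq 0]/csq /= expr0n /= addr0 mul0r addr0 csq_gt0 //.
by rewrite ltr_wpDl ?csq_ge0 // mulr_gt0 ?csq_gt0 ?exprn_gt0.
Qed.

Lemma det1_row1 g : \det g = 1 -> (g 1 0 != 0) || (g 1 1 != 0).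
Proof.
move=> /det1_mx2; apply: contra_eqT; rewrite negb_or !negbK => /andP[/eqP -> /eqP ->].
by rewrite !mulr0 subrr eq_sym oner_eq0.
Qed.

Lemma det1_row0 g : \det g = 1 -> (g 0 0 != 0) || (g 0 1 != 0).
Proof.
move=> /det1_mx2; apply: contra_eqT; rewrite negb_or !negbK => /andP[/eqP -> /eqP ->].
by rewrite !mul0r subrr eq_sym oner_eq0.
Qed.

Lemma mob_act_gt0 g p : \det g = 1 -> 0 < p.2 -> 0 < (mob_act g p).2.
Proof. by move=> /det1_row1 g0 p0; rewrite divr_gt0 // mob_den_gt0. Qed.

Lemma divc_real z (D : R) :
  z / Complex D 0 = Complex (complex.Re z / D) (complex.Im z / D).
Proof.
have [->|D0] := eqVneq D 0; first by rewrite !invr0 mulr0 -/(0 : C) !mulr0.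
by case: z => x y; apply: complex_eqP => /=; field.
Qed.

Lemma mob_act1 p : mob_act 1 p = p.
Proof.
case: p => -[x y] t; rewrite /mob_act /= !mxE /= divc_real /csq /=; congr pair; last by field.
by congr Complex; field.
Qed.

Lemma mob_act_upper b p : mob_act (upper b) p = translate b p.
Proof.
case: p b => -[x y] t [u v]; rewrite /mob_act /= !mxE /= divc_real /csq /=; congr pair => /=; last by field.
by congr Complex; field.
Qed.

Lemma mob_act_flip p : 0 < p.2 -> mob_act (flip C) p = flip_act p.
Proof.
case: p => -[x y] t /= t0; rewrite /mob_act /flip_act /= !mxE /= divc_real /csq /=.
have N0 : x ^+ 2 + y ^+ 2 + t ^+ 2 != 0 by nra.
congr pair => /=; last by field.
by congr Complex; field.
Qed.

Lemma mob_act_upperM b g p : \det g = 1 -> 0 < p.2 ->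
  mob_act (upper b * g) p = translate b (mob_act g p).
Proof.
move=> g1 p0; have := mob_den_gt0 p.1 p0 (det1_row1 g1).
rewrite [g in upper b * g]mx2_eta /upper mulmx2 /mob_act !mx2E !(mul0r, add0r, mul1r).
set D := (X in 0 < X) => D0; rewrite /translate; congr pair => /=.
have D'0 : Complex D 0 != 0 by rewrite eq_complex /= negb_and gt_eqF.
rewrite -[RHS](mulfK D'0) [in RHS]mulrDl mulfVK //; congr (_ / _).
have -> : Complex D 0 = (g 1 0 * p.1 + g 1 1) * cconj (g 1 0 * p.1 + g 1 1)
    + g 1 0 * cconj (g 1 0) * Complex (p.2 ^+ 2) 0.
  by rewrite -!csqE /D; apply: complex_eqP => /=; ring.
ring.
Qed.

Lemma mob_act_flipM g p : \det g = 1 -> 0 < p.2 ->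
  mob_act (flip C * g) p = flip_act (mob_act g p).
Proof.
move=> g1 p0; have := mob_den_gt0 p.1 p0 (det1_row1 g1).
have := mob_den_gt0 p.1 p0 (det1_row0 g1).
have := det1_mx2 g1.
rewrite [g in flip C * g]mx2_eta /flip mulmx2 /mob_act !mx2E.
rewrite !(mul0r, add0r, addr0, mul1r, mulN1r).
move: (g 0 0) (g 0 1) (g 1 0) (g 1 1) p p0 => a b c d [z t] /= t0.
set D' := csq _ + _; set D := csq _ + _ => h D'0 D0.
rewrite /flip_act /= !divc_real /=.
set N := _ * cconj (c * z + d) + _.
have -> : (- c * z - d) * cconj (a * z + b) + - c * cconj a * Complex (t ^+ 2) 0
    = - cconj N.
  rewrite /N; move: a b c d z {h D'0 D0 N D D'} => [? ?] [? ?] [? ?] [? ?] [? ?].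
  by apply: complex_eqP => /=; ring.
(* [D] and [D'] are the denominators for g and for [flip] times g. A Lagrange identity expresses
   their product; its second square carries the factor a(cz + d) - c(az + b), which is the
   determinant. *)
have NE : csq N + t ^+ 2 = D * D'.
  have <- : csq N + t ^+ 2 * csq (a * (c * z + d) - c * (a * z + b)) = D * D'.
    rewrite /D /D' /N; move: (c * z + d) (a * z + b) => v u.
    by clear; case: u v a c => [? ?] [? ?] [? ?] [? ?]; rewrite /csq /=; ring.
  have -> : a * (c * z + d) - c * (a * z + b) = 1 by rewrite -h; ring.
  by rewrite [csq 1]/csq /= expr1n expr0n /= addr0 mulr1.
have D0' : D != 0 by rewrite gt_eqF.
have D'0' : D' != 0 by rewrite gt_eqF.
have -> : csq (Complex (complex.Re N / D) (complex.Im N / D)) + (t / D) ^+ 2 = D' / D.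
  transitivity ((csq N + t ^+ 2) / D ^+ 2); first by rewrite /csq /=; field.
  by rewrite NE; field.
congr pair; last by field; rewrite D0'.
by apply: complex_eqP; case: N {NE} => ? ? /=; field; rewrite D0'.
Qed.

Lemma mob_actM g h p : \det g = 1 -> \det h = 1 -> 0 < p.2 ->
  mob_act (g * h) p = mob_act g (mob_act h p).
Proof.
move=> g1; move: g g1 h p.
pose P g := \det g = 1 /\ forall h p, \det h = 1 -> 0 < p.2 ->
  mob_act (g * h) p = mob_act g (mob_act h p).
suff PP g : \det g = 1 -> P g by move=> g g1 h p; apply: (PP g g1).2.
apply: SL2_gen => [b||{}g h [g1 gP] [h1 hP]].
- split=> [|h p h1 p0]; first by rewrite det_mx2; ring.
  by rewrite mob_act_upperM // mob_act_upper.
- split=> [|h p h1 p0]; first by rewrite det_mx2; ring.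
  by rewrite mob_act_flipM // mob_act_flip // mob_act_gt0.
- split=> [|k p k1 p0]; first by rewrite det_mulmx g1 h1 mulr1.
  rewrite -mulrA gP ?hP ?gP ?mob_act_gt0 //.
  by rewrite -[_ * _]/(_ *m _) det_mulmx h1 k1 mulr1.
Qed.

Lemma hcosh_translate b p q : hcosh (translate b p) (translate b q) = hcosh p q.
Proof. by rewrite /hcosh /translate /= (_ : _ - _ = p.1 - q.1) //; ring. Qed.

Lemma hcosh_flip_act p q : 0 < p.2 -> 0 < q.2 ->
  hcosh (flip_act p) (flip_act q) = hcosh p q.
Proof.
case: p q => -[x y] t [[u v] s] /= t0 s0; rewrite /hcosh /flip_act /csq /=.
have M0 : x ^+ 2 + y ^+ 2 + t ^+ 2 != 0 by nra.
have N0 : u ^+ 2 + v ^+ 2 + s ^+ 2 != 0 by nra.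
have t0' : t != 0 by rewrite gt_eqF.
have s0' : s != 0 by rewrite gt_eqF.
by field; rewrite ?M0 ?N0 ?t0' ?s0'.
Qed.

Lemma hcosh_mob_act g p q : \det g = 1 -> 0 < p.2 -> 0 < q.2 ->
  hcosh (mob_act g p) (mob_act g q) = hcosh p q.
Proof.
move=> g1; move: g g1 p q.
pose P g := \det g = 1 /\ forall p q, 0 < p.2 -> 0 < q.2 ->
  hcosh (mob_act g p) (mob_act g q) = hcosh p q.
suff PP g : \det g = 1 -> P g by move=> g g1; apply: (PP g g1).2.
apply: SL2_gen => [b||{}g h [g1 gP] [h1 hP]].
- split=> [|p q p0 q0]; first by rewrite det_mx2; ring.
  by rewrite !mob_act_upper hcosh_translate.
- split=> [|p q p0 q0]; first by rewrite det_mx2; ring.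
  by rewrite !mob_act_flip // hcosh_flip_act.
- split=> [|p q p0 q0]; first by rewrite det_mulmx g1 h1 mulr1.
  by rewrite !mob_actM // gP ?mob_act_gt0 // hP.
Qed.

Lemma base_transitive p : 0 < p.2 ->
  exists g, \det g = 1 /\ mob_act g p = (0, 1).
Proof.
case: p => -[u v] t /= t0; have s0 : 0 < Num.sqrt t by rewrite sqrtr_gt0.
have s0' : Num.sqrt t != 0 by rewrite gt_eqF.
(* The map z |-> (z - (u + iv)) / t, with entries scaled by the square root of [t] to reach
   determinant 1. *)
pose s := Num.sqrt t; exists (mx2 (Complex s^-1 0) (Complex (- u / s) (- v / s)) 0 (Complex s 0)).
have ts : t = s ^+ 2 by rewrite sqr_sqrtr // ltW.
split; first by rewrite det_mx2; apply: complex_eqP => /=; field.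
rewrite /mob_act !mx2E /= divc_real /csq /=; congr pair; last by rewrite ts; field.
by apply: complex_eqP => /=; rewrite ts; field.
Qed.

Lemma rotate_to_axis q : 0 < q.2 ->
  exists g, [/\ \det g = 1, mob_act g (0, 1) = (0, 1) & (mob_act g q).1 = 0].
Proof.
case: q => -[u v] t t0; rewrite /= in t0; pose W := u ^+ 2 + v ^+ 2.
have [W0|Wn0] := eqVneq W 0.
  exists 1; split; rewrite ?det1 ?mob_act1 //.
  rewrite /=; move/eqP: W0; rewrite paddr_eq0 ?sqr_ge0 // !sqrf_eq0 => /andP[/eqP -> /eqP ->].
  by [].
have W0 : 0 < W by rewrite lt0r Wn0 addr_ge0 ?sqr_ge0.
(* The matrix sought is unitary, hence fixes (0, 1): it is x times [[1, y w], [-y conj w, 1]] with w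
   = u + iv. The image of the given point lies on the axis when y solves the quadratic [yE], and x
   normalises the determinant. *)
pose B := 1 - W - t ^+ 2; pose S := Num.sqrt (B ^+ 2 + 4 * W).
have SE : S ^+ 2 = B ^+ 2 + 4 * W by rewrite sqr_sqrtr //; nra.
pose y := (B + S) / (2 * W).
have yE : W * y ^+ 2 - B * y - 1 = 0.
  have -> : W * y ^+ 2 - B * y - 1 = (S ^+ 2 - B ^+ 2 - 4 * W) / (4 * W).
    by rewrite /y; field.
  by rewrite SE; field.
have n0 : 0 < 1 + y ^+ 2 * W by nra.
pose x := (Num.sqrt (1 + y ^+ 2 * W))^-1.
have xE : x ^+ 2 * (1 + y ^+ 2 * W) = 1.
  by rewrite exprVn sqr_sqrtr ?ltW // mulVf // gt_eqF.
exists (mx2 (Complex x 0) (Complex (x * y * u) (x * y * v))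
  (Complex (- x * y * u) (x * y * v)) (Complex x 0)); split.
- rewrite det_mx2; apply: complex_eqP => /=; last by ring.
  by rewrite -[RHS]xE /W; ring.
- rewrite /mob_act !mx2E /= (_ : csq _ + _ = 1) ?divc_real ?divr1; last first.
    by rewrite -[RHS]xE /csq /W /=; ring.
  by congr pair; apply: complex_eqP => /=; ring.
- rewrite /mob_act !mx2E /= divc_real (_ : _ + _ = 0) ?mul0r //.
  have h : 1 + y - y * W - y ^+ 2 * W - y * t ^+ 2 = 0.
    by rewrite -[RHS]oppr0 -yE /B; ring.
  apply: complex_eqP => /=.
    transitivity (x ^+ 2 * u * (1 + y - y * W - y ^+ 2 * W - y * t ^+ 2)).
      by rewrite /W; ring.
    by rewrite h mulr0.
  transitivity (x ^+ 2 * v * (1 + y - y * W - y ^+ 2 * W - y * t ^+ 2)).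
    by rewrite /W; ring.
  by rewrite h mulr0.
Qed.

Lemma pair_to_axis p q : 0 < p.2 -> 0 < q.2 ->
  exists g (T : R), [/\ \det g = 1, 1 <= T, mob_act g p = (0, 1) & mob_act g q = (0, T)].
Proof.
move=> p0 q0; have [g [g1 gp]] := base_transitive p0.
have [k [k1 kj kq]] := rotate_to_axis (mob_act_gt0 g1 q0).
have kg1 : \det (k * g) = 1 by rewrite det_mulmx k1 g1 mulr1.
have kgp : mob_act (k * g) p = (0, 1) by rewrite mob_actM // gp.
have [T [T0 kgq]] : exists T, 0 < T /\ mob_act (k * g) q = (0, T).
  exists (mob_act (k * g) q).2; split; first exact: mob_act_gt0.
  by rewrite mob_actM // [LHS]surjective_pairing kq.
have [T1|T1] := leP 1 T; first by exists (k * g), T.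
have f1 : \det (flip C) = 1 by rewrite det_mx2; ring.
have fE s : 0 < s -> mob_act (flip C) (0, s) = (0, s^-1).
  move=> s0; rewrite mob_act_flip // /flip_act /csq /= !oppr0 !mul0r expr0n !add0r.
  by congr pair; field; rewrite gt_eqF.
exists (flip C * (k * g)), T^-1; split.
- by rewrite det_mulmx f1 kg1 mulr1.
- by rewrite invf_ge1 // ltW.
- by rewrite mob_actM // kgp fE // invr1.
- by rewrite mob_actM // kgq fE.
Qed.

Lemma hcosh_axis (T : R) : 0 < T -> hcosh (0, 1) (0, T) = (T + T^-1) / 2.
Proof.
by move=> T0; rewrite /hcosh /= subrr /csq /=; field; rewrite gt_eqF.
Qed.

Lemma hdist_axis p q (T : R) : 1 <= T -> hcosh p q = (T + T^-1) / 2 ->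
  hdist p q = ln T.
Proof.
move=> T1 h; have T0 : 0 < T by exact: lt_le_trans ltr01 T1.
have T0' : T != 0 by rewrite gt_eqF.
rewrite /hdist h; have -> : ((T + T^-1) / 2) ^+ 2 - 1 = ((T - T^-1) / 2) ^+ 2 by field.
rewrite sqrtr_sqr ger0_norm; first by congr ln; field.
rewrite divr_ge0 // subr_ge0 (le_trans _ T1) // invf_le1 //.
Qed.

(** Elements moving the base point a bounded distance thus have bounded entries, which is how
    discreteness of the matrices will make orbits finite in balls. The determinant enters the
    computation as 1 = |ad - bc|^2. *)
Lemma hcosh_base_mob_act g : \det g = 1 -> hcosh (0, 1) (mob_act g (0, 1)) = mxnsq g / 2.
Proof.
move=> g1; have := mob_den_gt0 0 (@ltr01 R) (det1_row1 g1).
have := det1_mx2 g1; rewrite /mxnsq !big_ord_recl !big_ord0 /= !addr0.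
rewrite (_ : lift ord0 ord0 = 1); last exact/val_inj.
rewrite /hcosh /mob_act /= divc_real !mulr0 !add0r.
move: (g 0 0) (g 0 1) (g 1 0) (g 1 1) => a b c d h.
rewrite expr1n mulr1; set D := csq d + _ => D0; set N := b * _ + _.
have D0' : D != 0 by rewrite gt_eqF.
have NE : csq N = D * (csq a + csq b) - 1.
  have -> : 1 = csq (a * d - b * c) by rewrite h /csq /= expr1n expr0n /= addr0.
  rewrite /N /D; clear; case: a b c d => [? ?] [? ?] [? ?] [? ?].
  by rewrite /csq /=; ring.
rewrite (_ : csq _ = csq N / D ^+ 2); last first.
  by rewrite /csq; case: N {NE} => ? ? /=; field.
by rewrite NE (_ : csq c + csq d = D) /D; [field|ring].
Qed.
End HalfSpace.

(** * The invariant volume *)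

Section LebesgueInvariance.
Context {R : realType}.
Local Open Scope ereal_scope.

(* Packed once as a sigma-finite measure, so that the Fubini lemmas unify syntactically. *)
Definition leb : {sigma_finite_measure set (measurableTypeR R) -> \bar R} :=
  @lebesgue_measure R.
Local Notation mu := leb.
Local Notation RM := (measurableTypeR R).

Lemma lebesgue_measure_shift (c : R) (A : set R) : measurable A ->
  pushforward mu ((fun x => x + c)%R : _ -> measurableTypeR R) A = mu A.
Proof.
move=> mA; have mf : measurable_fun setT ((fun x => x + c)%R : measurableTypeR R -> measurableTypeR R).
  exact: measurable_funD.
apply/esym; pose phi : {mfun measurableTypeR R >-> measurableTypeR R} :=
  HB.pack (fun x : measurableTypeR R => (x + c)%R : RM) (isMeasurableFun.Build _ _ _ _ _ mf).
apply: (@lebesgue_measure_unique R (pushforward mu phi)) => // _ [[a b]] _ <-.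
transitivity (mu `](a - c)%R, (b - c)%R]).
  rewrite /leb /= !lebesgue_measure_itv /= !lte_fin ltrD2r.
  by case: ifP => // _; rewrite -!EFinD; congr EFin; ring.
by congr (mu _); apply/seteqP; split => x /=; rewrite !in_itv /= ltrBlDr lerBrDr.
Qed.

Lemma ge0_integral_shift (f : R -> \bar R) (c : R) :
  measurable_fun setT f -> (forall x, 0 <= f x) ->
  \int[mu]_x f (x + c)%R = \int[mu]_x f x.
Proof.
move=> mf f0; pose phi : measurableTypeR R -> measurableTypeR R := fun x => (x + c)%R.
have mphi : measurable_fun setT phi by exact: measurable_funD.
transitivity (\int[pushforward mu phi]_x f x).
  by rewrite ge0_integral_pushforward // => y _.
by apply: eq_measure_integral => A mA _; exact: lebesgue_measure_shift.
Qed.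

Lemma ge0_integral_opp (f : R -> \bar R) :
  measurable_fun setT f -> (forall x, 0 <= f x) ->
  \int[mu]_x f (- x)%R = \int[mu]_x f x.
Proof.
move=> mf f0; pose phi : measurableTypeR R -> measurableTypeR R := fun x => (- x)%R.
have mphi : measurable_fun setT phi by exact: oppr_measurable.
transitivity (\int[pushforward mu phi]_x f x).
  by rewrite ge0_integral_pushforward // => y _.
by apply: eq_measure_integral => A mA _; exact: lebesgue_measureN.
Qed.

(** Fubini reduces this to a reflection and a translation on each fibre. It is the form that the
    inversion takes in the coordinates of [hpt]. *)
Lemma ge0_integral_reflect d (T : measurableType d)
    (m : {sigma_finite_measure set T -> \bar R}) (f : T * RM -> \bar R) (c : T -> R) :
  measurable_fun setT c -> measurable_fun setT f -> (forall x, 0 <= f x) ->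
  \int[m \x mu]_x f (x.1, - x.2 + c x.1)%R = \int[m \x mu]_x f x.
Proof.
move=> mc mf f0.
have mh : measurable_fun setT (fun x : T * RM => (x.1, (- x.2 + c x.1)%R : RM)).
  apply: measurable_fun_pair => //; apply: measurable_funD.
    exact: measurableT_comp.
  exact: measurableT_comp mc _.
have mf' := measurableT_comp mf mh.
rewrite [RHS](fubini_tonelli1 _ mf f0).
rewrite [LHS](fubini_tonelli1 _ mf' (fun x => f0 _)).
apply: eq_integral => p _; rewrite /fubini_F /=.
have mfp : measurable_fun setT (fun s => f (p, s)).
  by apply: measurableT_comp mf _; apply: measurable_fun_pair.
rewrite -[RHS](ge0_integral_shift (c p)) // -[RHS]ge0_integral_opp //.
by apply: (measurableT_comp mfp); exact: measurable_funD.
Qed.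

Lemma ge0_integral2_shift (f : RM * RM -> \bar R) (u v : R) :
  measurable_fun setT f -> (forall x, 0 <= f x) ->
  \int[mu \x mu]_p f (p.1 + u, p.2 + v)%R = \int[mu \x mu]_p f p.
Proof.
move=> mf f0.
have mphi : measurable_fun setT (fun p : RM * RM => ((p.1 + u)%R : RM, (p.2 + v)%R : RM)).
  by apply: measurable_fun_pair; apply: measurable_funD.
have mf' := measurableT_comp mf mphi.
rewrite [RHS](fubini_tonelli1 _ mf f0).
rewrite [LHS](fubini_tonelli1 _ mf' (fun x => f0 _)).
rewrite /fubini_F /=; transitivity (\int[mu]_x \int[mu]_y f (x + u, y)%R).
  apply: eq_integral => x _; rewrite (ge0_integral_shift (f := fun y => f (x + u, y)%R)) //.
  by apply: measurableT_comp mf _; apply: measurable_fun_pair.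
rewrite (ge0_integral_shift (f := fun x => \int[mu]_y f (x, y))) //.
  exact: measurable_fun_fubini_tonelli_F.
by move=> x; apply: integral_ge0.
Qed.
End LebesgueInvariance.

(** * Coordinates in which hyperbolic volume is Lebesgue measure *)

Section InvariantVolume.
Context {R : realType}.
Local Notation C := R[i].
Local Notation mu := (@leb R).
Local Notation RM := (measurableTypeR R).

(* The library only declares products of subprobabilities as sigma-finite. *)
Definition leb2 : set (RM * RM)%type -> \bar R := (mu \x mu)%E.

HB.instance Definition _ := Measure.on leb2.

Let sigma_finite_leb2 : sigma_finite setT leb2.
Proof.
have /sigma_finiteP[F [FT ndF Foo]] := sigma_finiteT mu.
exists (fun n => F n `*` F n).
  rewrite predeqE => -[x y]; split=> // _.
  have [m _ Fx] : (\bigcup_i F i) x by rewrite -FT.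
  have [n _ Fy] : (\bigcup_i F i) y by rewrite -FT.
  exists (maxn m n) => //; split => /=.
    by move: x Fx; exact/subsetPset/ndF/leq_maxl.
  by move: y Fy; exact/subsetPset/ndF/leq_maxr.
move=> n; have [mF Fn] := Foo n; split; first exact: measurableX.
by rewrite /leb2 product_measure1E // lte_mul_pinfty // ge0_fin_numE.
Qed.

HB.instance Definition _ := Measure_isSigmaFinite.Build _ _ _ leb2 sigma_finite_leb2.

Local Notation mu3 := (leb2 \x mu)%E.
Implicit Types (F : C * R -> R) (g : 'M[C]_2).

(* With z = e^s (a + ib) and t = e^s, the hyperbolic volume dx dy dt / t^3 is da db ds. *)
Definition hpt (x : RM * RM * RM) : C * R :=
  (Complex (expR x.2 * x.1.1) (expR x.2 * x.1.2), expR x.2).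

(** Measurability and integrals are pulled back along [hpt], so no sigma-algebra on the pairs (z, t)
    is involved and only points of positive height matter. *)
Definition hmeasurable F := measurable_fun setT (F \o hpt).

Definition hintegral F : \bar R := (\int[mu3]_x (F (hpt x))%:E)%E.

Lemma hpt_gt0 x : 0 < (hpt x).2.
Proof. exact: expR_gt0. Qed.

Definition translate_coord (b : C) (x : RM * RM * RM) : RM * RM * RM :=
  ((x.1.1 + complex.Re b * expR (- x.2), x.1.2 + complex.Im b * expR (- x.2)), x.2).

(** Since |z|^2 + t^2 = e^(2s) (1 + a^2 + b^2), dividing t = e^s by it sends s to -s - ln(1 + a^2 +
    b^2), while z/t only changes the sign of its real part. Both changes preserve Lebesgue
    measure. *)
Definition flip_coord (x : RM * RM * RM) : RM * RM * RM :=
  ((- x.1.1, x.1.2), - x.2 - ln (1 + x.1.1 ^+ 2 + x.1.2 ^+ 2)).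

Lemma hpt_translate b x : hpt (translate_coord b x) = translate b (hpt x).
Proof.
case: x b => [[a b] s] [u v]; rewrite /hpt /translate /=; congr pair.
by apply: complex_eqP => /=; rewrite mulrDr mulrCA expRxMexpNx_1 mulr1.
Qed.

Lemma hpt_flip x : hpt (flip_coord x) = flip_act (hpt x).
Proof.
case: x => [[a b] s]; rewrite /hpt /flip_act /csq /=.
have W0 : 0 < 1 + a ^+ 2 + b ^+ 2 by nra.
rewrite expRD expRN expRN lnK ?posrE //.
have E0 : expR s != 0 by rewrite gt_eqF ?expR_gt0.
have N0 : (expR s * a) ^+ 2 + (expR s * b) ^+ 2 + expR s ^+ 2 != 0.
  by rewrite gt_eqF // ltr_wpDl ?exprn_gt0 ?expR_gt0 // addr_ge0 ?sqr_ge0.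
have W0' : 1 + a ^+ 2 + b ^+ 2 != 0 by rewrite gt_eqF.
congr pair; last by field; rewrite E0 W0' N0.
by apply: complex_eqP => /=; field; rewrite E0 W0' N0.
Qed.

Lemma measurable_translate_coord b : measurable_fun setT (translate_coord b).
Proof.
have m2 : measurable_fun setT (fun x : RM * RM * RM => expR (- x.2)).
  by apply: measurableT_comp (@measurable_expR R) _; exact: measurableT_comp.
apply: measurable_fun_pair => //; apply: measurable_fun_pair; apply: measurable_funD.
- exact: measurableT_comp.
- exact: measurable_funM.
- exact: measurableT_comp.
- exact: measurable_funM.
Qed.

Lemma measurable_flip_coord : measurable_fun setT flip_coord.
Proof.
have m1 : measurable_fun setT (fun x : RM * RM * RM => x.1.1) by exact: measurableT_comp.
have m2 : measurable_fun setT (fun x : RM * RM * RM => x.1.2) by exact: measurableT_comp.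
apply: measurable_fun_pair.
  by apply: measurable_fun_pair => //; exact: measurableT_comp.
apply: measurable_funB; first exact: measurableT_comp.
apply: measurableT_comp (@measurable_ln R) _.
by apply: measurable_funD; [apply: measurable_funD => //|]; exact: measurable_funX.
Qed.

Lemma integral_translate_coord b (f : RM * RM * RM -> \bar R) :
  measurable_fun setT f -> (forall x, 0 <= f x)%E ->
  (\int[mu3]_x f (translate_coord b x) = \int[mu3]_x f x)%E.
Proof.
move=> mf f0.
have mf' := measurableT_comp mf (measurable_translate_coord b).
rewrite [RHS](fubini_tonelli2 _ mf f0).
rewrite [LHS](fubini_tonelli2 _ mf' (fun x => f0 _)).
apply: eq_integral => s _; rewrite /fubini_G.
have mfs : measurable_fun setT (fun p : RM * RM => f (p, s)).
  by apply: measurableT_comp mf _; apply: measurable_fun_pair.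
exact: (ge0_integral2_shift (complex.Re b * expR (- s)) (complex.Im b * expR (- s)) mfs).
Qed.

Lemma integral_flip_coord (f : RM * RM * RM -> \bar R) :
  measurable_fun setT f -> (forall x, 0 <= f x)%E ->
  (\int[mu3]_x f (flip_coord x) = \int[mu3]_x f x)%E.
Proof.
move=> mf f0.
pose fl (p : RM * RM) : RM * RM := (- p.1, p.2)%R.
pose c := fun p : RM * RM => - ln (1 + p.1 ^+ 2 + p.2 ^+ 2).
have mc : measurable_fun setT c.
  apply: measurableT_comp => //; apply: measurableT_comp (@measurable_ln R) _.
  by apply: measurable_funD; [apply: measurable_funD => //|]; exact: measurable_funX.
have mfl : measurable_fun setT fl.
  by apply: measurable_fun_pair => //; exact: measurableT_comp.
have mf1 : measurable_fun setT (fun x : RM * RM * RM => f (fl x.1, x.2)).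
  apply: measurableT_comp mf _; apply: measurable_fun_pair => //.
  exact: measurableT_comp.
transitivity (\int[mu3]_x f (fl x.1, x.2))%E.
  exact: (ge0_integral_reflect leb2 mc mf1 (fun x => f0 _)).
rewrite [RHS](fubini_tonelli2 _ mf f0).
rewrite [LHS](fubini_tonelli2 _ mf1 (fun x => f0 _)).
apply: eq_integral => s _; rewrite /fubini_G.
have mfs : measurable_fun setT (fun p : RM * RM => f (p, s)).
  by apply: measurableT_comp mf _; apply: measurable_fun_pair.
rewrite [RHS](fubini_tonelli2 _ mfs (fun x => f0 _)).
rewrite [LHS](fubini_tonelli2 _ (measurableT_comp mfs mfl) (fun x => f0 _)).
apply: eq_integral => y _; rewrite /fubini_G.
rewrite (ge0_integral_opp (f := fun x => f ((x, y), s))) //.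
by apply: (measurableT_comp mfs); apply: measurable_fun_pair.
Qed.

(** Measurability belongs to the same induction because the step for a product integrates
    [F \o mob_act g] in place of [F]. *)
Lemma hintegral_mob_act g F : \det g = 1 -> hmeasurable F ->
  hmeasurable (F \o mob_act g) /\
  ((forall p, 0 <= F p) -> hintegral (F \o mob_act g) = hintegral F).
Proof.
move=> g1; move: g g1 F.
pose P g := \det g = 1 /\ forall F, hmeasurable F ->
  hmeasurable (F \o mob_act g) /\
  ((forall p, 0 <= F p) -> hintegral (F \o mob_act g) = hintegral F).
suff PP g : \det g = 1 -> P g by move=> g g1; apply: (PP g g1).2.
apply: SL2_gen => [b||{}g h [g1 gP] [h1 hP]].
- split=> [|F mF]; first by rewrite det_mx2; ring.
  have E x : (F \o mob_act (upper b)) (hpt x) = (F \o hpt) (translate_coord b x).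
    by rewrite /= hpt_translate mob_act_upper.
  split.
    rewrite /hmeasurable (_ : _ \o hpt = (F \o hpt) \o translate_coord b); last exact/funext.
    exact: measurableT_comp mF (measurable_translate_coord b).
  move=> F0; rewrite /hintegral; under eq_integral do rewrite E.
  apply: (integral_translate_coord _ (f := EFin \o (F \o hpt))); first exact/measurable_EFinP.
  by move=> x; rewrite lee_fin /=; exact: F0.
- split=> [|F mF]; first by rewrite det_mx2; ring.
  have E x : (F \o mob_act (flip C)) (hpt x) = (F \o hpt) (flip_coord x).
    by rewrite /= hpt_flip mob_act_flip // hpt_gt0.
  split.
    rewrite /hmeasurable (_ : _ \o hpt = (F \o hpt) \o flip_coord); last exact/funext.
    exact: measurableT_comp mF measurable_flip_coord.
  move=> F0; rewrite /hintegral; under eq_integral do rewrite E.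
  apply: (integral_flip_coord (f := EFin \o (F \o hpt))); first exact/measurable_EFinP.
  by move=> x; rewrite lee_fin /=; exact: F0.
- split=> [|F mF]; first by rewrite det_mulmx g1 h1 mulr1.
  have E x : (F \o mob_act (g * h)) (hpt x) = ((F \o mob_act g) \o mob_act h) (hpt x).
    by rewrite /= mob_actM // hpt_gt0.
  have [mg gI] := gP F mF; have [mh hI] := hP _ mg.
  split; first by rewrite /hmeasurable (_ : _ \o hpt = ((F \o mob_act g) \o mob_act h) \o hpt) //; exact/funext.
  move=> F0; rewrite -gI // -hI; last by move=> p; exact: F0.
  rewrite /hintegral; apply: eq_integral => x _.
  by congr EFin; exact: E.
Qed.
End InvariantVolume.

(** * Powers of cosh and their tails *)

Section OneDimensional.
Context {R : realType}.
Implicit Types (x y s : R).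

Definition ch x : R := (expR x + expR (- x)) / 2.

Lemma ch_ge1 x : 1 <= ch x.
Proof.
have e0 := expR_gt0 x; rewrite /ch expRN.
have -> : (expR x + (expR x)^-1) / 2 = 1 + (expR x - 1) ^+ 2 / (2 * expR x).
  by field; rewrite gt_eqF.
by rewrite lerDl divr_ge0 ?sqr_ge0 // mulr_ge0 // ltW.
Qed.

Lemma ch_gt0 x : 0 < ch x.
Proof. exact: lt_le_trans ltr01 (ch_ge1 x). Qed.

Lemma chN x : ch (- x) = ch x.
Proof. by rewrite /ch opprK addrC. Qed.

Lemma ch_norm x : ch `|x| = ch x.
Proof. by have [x0|x0] := leP 0 x; rewrite ?(ger0_norm x0) ?(ltr0_norm x0) ?chN. Qed.

Lemma ch_le x y : 0 <= x <= y -> ch x <= ch y.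
Proof.
move=> /andP[x0 xy]; rewrite /ch !expRN ler_pM2r ?invr_gt0 //.
have ex := expR_gt0 x; have ey := expR_gt0 y.
have e1 : 1 <= expR x by rewrite -expR0 ler_expR.
have exy : expR x <= expR y by rewrite ler_expR.
rewrite -subr_ge0 (_ : _ - _ = (expR y - expR x) * (expR x * expR y - 1) / (expR x * expR y)); last first.
  by field; rewrite !gt_eqF.
rewrite divr_ge0 ?mulr_ge0 ?(ltW ex) ?(ltW ey) ?subr_ge0 //; nra.
Qed.

Lemma is_derive_ch x : is_derive x 1 ch ((expR x - expR (- x)) / 2).
Proof.
rewrite (_ : ch = 2^-1 *: (expR + (expR \o -%R))); last first.
  by apply/funext => y; rewrite /ch !fctE /= mulrC.
by apply: is_derive_eq; rewrite /GRing.scale /=; ring.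
Qed.

Lemma continuous_ch : continuous ch.
Proof.
move=> x; apply: differentiable_continuous; apply/derivable1_diffP.
by have [] := is_derive_ch x.
Qed.

Definition ch_pow s x : R := ch x `^ (- s).

Lemma ch_powE s x : ch_pow s x = expR (- s * ln (ch x)).
Proof. by rewrite /ch_pow /powR gt_eqF // ch_gt0. Qed.

Lemma ch_pow_ge0 s x : 0 <= ch_pow s x. Proof. exact: powR_ge0. Qed.

Lemma ch_powN s x : ch_pow s (- x) = ch_pow s x.
Proof. by rewrite /ch_pow chN. Qed.

Lemma ch_pow_norm s x : ch_pow s `|x| = ch_pow s x.
Proof. by rewrite /ch_pow ch_norm. Qed.

Lemma ch_pow_le s x y : 0 <= s -> 0 <= x <= y -> ch_pow s y <= ch_pow s x.
Proof.
move=> s0 xy; rewrite !ch_powE ler_expR !mulNr lerN2 ler_wpM2l // ler_ln ?posrE ?ch_gt0 //.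
exact: ch_le.
Qed.

Lemma continuous_ch_pow s : continuous (ch_pow s).
Proof.
move=> x; rewrite (_ : ch_pow s = expR \o ( *%R (- s)) \o (@ln R) \o ch); last first.
  by apply/funext => y; rewrite ch_powE.
apply: continuous_comp; first exact: continuous_ch.
apply: continuous_comp; first exact/continuous_ln/ch_gt0.
apply: continuous_comp; last exact: continuous_expR.
exact: mulrl_continuous.
Qed.

Lemma measurable_ch_pow s : measurable_fun setT (ch_pow s).
Proof. exact: continuous_measurable_fun (@continuous_ch_pow s). Qed.

(** This is tanh x - 1, the primitive of cosh^-2 that vanishes at +oo. *)
Definition ch_prim x : R := - 2 / (1 + expR (2 * x)).

Lemma ch_pow2E x : ch_pow 2 x = 4 * expR (2 * x) / (1 + expR (2 * x)) ^+ 2.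
Proof.
rewrite /ch_pow powR_invn ?(ltW (ch_gt0 x)) // /ch expRN expRM_natl.
have e0 := expR_gt0 x; have e0' : expR x != 0 by rewrite gt_eqF.
have ? : 1 + expR x ^+ 2 != 0 by rewrite gt_eqF // ltr_pwDl // sqr_ge0.
have ? : expR x + (expR x)^-1 != 0 by rewrite gt_eqF // addr_gt0 ?invr_gt0.
by field; rewrite e0' /=; apply/andP.
Qed.

Lemma is_derive_ch_prim x : is_derive x 1 ch_prim (ch_pow 2 x).
Proof.
have h0 : 1 + expR (2 * x) != 0 by rewrite gt_eqF // addr_gt0 ?expR_gt0.
have h1 : is_derive x 1 (fun y => 1 + expR (2 * y)) (2 * expR (2 * x)).
  rewrite (_ : (fun y => _) = cst 1 + (expR \o (2 *: id))); last exact/funext.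
  by apply: is_derive_eq; rewrite /GRing.scale /= add0r mulr1 mulrC.
have h2 := @is_deriveV _ (fun y => 1 + expR (2 * y)) x _ 1 h0 h1.
rewrite (_ : ch_prim = -2 *: (fun y => (1 + expR (2 * y))^-1)); last exact/funext.
by apply: is_derive_eq; rewrite ch_pow2E /GRing.scale /=; field.
Qed.

Lemma ch_prim_cvg : ch_prim x @[x --> +oo] --> 0.
Proof.
have bnd x : `|ch_prim x| <= 2 * expR (- x).
  have e0 := expR_gt0 x; rewrite /ch_prim mulNr normrN ger0_norm; last first.
    by rewrite divr_ge0 // addr_ge0 // expR_ge0.
  rewrite expRN expRM_natl ler_pM2l // lef_pV2 ?posrE // ?addr_gt0 ?exprn_gt0 //.
  by nra.
apply/cvgr0Pnorm_le => e e0.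
have c0 : 2 * expR (- x) @[x --> +oo] --> (0 : R).
  by rewrite -[X in _ --> X](mulr0 2); apply: cvgM (@cvgr_expR R); exact: cvg_cst.
near=> x; apply: le_trans (bnd x) _.
apply: le_trans (ler_norm _) _; near: x.
by move/cvgr0Pnorm_le : c0; apply.
Unshelve. all: by end_near. Qed.

Lemma is_derive_continuous (F : R -> R) (f : R -> R) :
  (forall x, is_derive x 1 F (f x)) -> continuous F.
Proof.
by move=> dF x; apply: differentiable_continuous; apply/derivable1_diffP; have [] := dF x.
Qed.

Lemma FTC_segment (F f : R -> R) a b : a < b ->
  (forall x, is_derive x 1 F (f x)) -> continuous f ->
  (\int[@lebesgue_measure R]_(x in `[a, b]) (f x)%:E = (F b - F a)%:E)%E.
Proof.
move=> ab dF cf; have cF := is_derive_continuous dF.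
rewrite (@continuous_FTC2 _ f F) //.
- exact: continuous_subspaceT.
- split; first by move=> x _; have [] := dF x.
  + exact/cvg_at_right_filter/cF.
  + exact/cvg_at_left_filter/cF.
- by move=> x _; rewrite derive1E; have [_ ->] := dF x.
Qed.

Lemma FTC_halfline (F f : R -> R) (a l : R) : (forall x, 0 <= f x) ->
  (forall x, is_derive x 1 F (f x)) -> continuous f -> F x @[x --> +oo] --> l ->
  (\int[@lebesgue_measure R]_(x in `[a, +oo[) (f x)%:E = (l - F a)%:E)%E.
Proof.
move=> f0 dF cf Fl; have cF := is_derive_continuous dF.
rewrite (@ge0_continuous_FTC2y _ f F a l) //.
- exact: continuous_subspaceT.
- exact/cvg_at_right_filter/cF.
- by move=> x _; rewrite derive1E; have [_ ->] := dF x.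
Qed.

Lemma ch_pow_add s e x : ch_pow (s + e) x = ch_pow s x * ch_pow e x.
Proof. by rewrite !ch_powE -expRD; congr expR; ring. Qed.

Local Opaque ch_pow.

(** At s = 2 the primitive gives exactly 2, and the integrand decreases in s because cosh is at
    least 1. *)
Lemma integral_ch_pow_le s : 2 <= s ->
  (\int[@lebesgue_measure R]_x (ch_pow s x)%:E <= 2%:E)%E.
Proof.
move=> s2; rewrite ge0_symfun_integralT; last 3 first.
- exact: ch_pow_ge0.
- exact: continuous_ch_pow.
- by move=> x; rewrite /= ch_powN.
rewrite -[leRHS]mule1 lee_pmul2l //.
have -> : (1 = \int[@lebesgue_measure R]_(x in `[0%R, +oo[) (ch_pow 2 x)%:E)%E.
  rewrite (FTC_halfline 0 (ch_pow_ge0 2) is_derive_ch_prim (@continuous_ch_pow 2) ch_prim_cvg).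
  by rewrite /ch_prim mulr0 expR0; congr EFin; field.
rewrite -set_itvcy; apply: ge0_le_integral => //.
- by move=> x _; rewrite lee_fin ch_pow_ge0.
- by apply/measurable_EFinP; apply: measurable_funTS (measurable_ch_pow _).
- by apply/measurable_EFinP; apply: measurable_funTS (measurable_ch_pow _).
- move=> x _; rewrite lee_fin !ch_powE ler_expR ler_wpM2r ?lerN2 //.
  by rewrite ln_ge0 // ch_ge1.
Qed.


(** On [0, M] the excess factor ch^-e is at least its value at M + x, and the remaining ch^-2 is
    integrated exactly. For M large and e small the bound tends to -2 [ch_prim x]. *)
Lemma integral_ch_pow_shift_ge (e x M : R) : 0 <= e -> 0 <= x -> 0 < M ->
  ((2 * (ch_pow e (M + x) * (ch_prim (M + x) - ch_prim x)))%:E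
   <= \int[@lebesgue_measure R]_l (ch_pow (2 + e) (`|l| + x))%:E)%E.
Proof.
move=> e0 x0 M0; have e2 : 0 <= 2 + e by rewrite addr_ge0.
have cf s : continuous (fun l : R => ch_pow s (`|l| + x)).
  move=> l; apply: (@continuous_comp _ _ _ (fun l : R => `|l| + x) (ch_pow s)); last exact: continuous_ch_pow.
  by apply: continuousD; [exact: norm_continuous|exact: cst_continuous].
have mf s D : measurable_fun D (fun l : R => (ch_pow s (`|l| + x))%:E).
  by apply/measurable_EFinP; apply: measurable_funTS; exact: continuous_measurable_fun (cf s).
rewrite ge0_symfun_integralT; last 3 first.
- by move=> l; exact: ch_pow_ge0.
- exact: cf.
- by move=> l; rewrite /= normrN.
rewrite EFinM lee_pmul2l // -set_itvcy.
apply: (@le_trans _ _ (\int[@lebesgue_measure R]_(l in `[0%R, M]) (ch_pow (2 + e) (`|l| + x))%:E)%E); last first.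
  apply: ge0_subset_integral => //.
  - exact: mf.
  - by move=> l _; rewrite lee_fin ch_pow_ge0.
  - by move=> l /=; rewrite !in_itv /= => /andP[-> _].
pose G l := ch_pow e (M + x) * ch_prim (l + x).
have dG (l : R) : is_derive l 1 G (ch_pow e (M + x) * ch_pow 2 (l + x)).
  have h1 := is_derive_ch_prim (l + x).
  have h2 : is_derive l 1 (shift x) 1 := is_derive_shift l 1 x.
  have h3 : is_derive l 1 (ch_prim \o shift x) (ch_pow 2 (l + x)).
    by rewrite -[ch_pow _ _]mulr1; exact: is_derive1_comp.
  rewrite (_ : G = ch_pow e (M + x) *: (ch_prim \o shift x)); last exact/funext.
  exact: (@is_deriveZ _ _ _ _ (ch_pow e (M + x)) _ _ _ h3).
have cg : continuous (fun l : R => ch_pow e (M + x) * ch_pow 2 (l + x)).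
  move=> l; apply: (@continuous_comp _ _ _ (fun l : R => ch_pow 2 (l + x)) ( *%R (ch_pow e (M + x)))).
    apply: (@continuous_comp _ _ _ (fun l : R => l + x) (ch_pow 2)); last exact: continuous_ch_pow.
    by apply: continuousD; [exact: cvg_id|exact: cst_continuous].
  exact: mulrl_continuous.
have := FTC_segment M0 dG cg; rewrite /G add0r -mulrBr => <-.
apply: ge0_le_integral => //.
- by move=> l _; rewrite lee_fin mulr_ge0 ?ch_pow_ge0.
- by apply/measurable_EFinP; apply: measurable_funTS; exact: continuous_measurable_fun cg.
- exact: mf.
move=> l /=; rewrite in_itv /= => /andP[l0 lM]; rewrite lee_fin (ger0_norm l0).
rewrite (ch_pow_add 2 e) mulrC; apply: ler_wpM2l; first exact: ch_pow_ge0.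
by apply: ch_pow_le e0 _; rewrite addr_ge0 // lerD2r.
Qed.

(** Seen from the midpoint of the two centres, which are t apart, each centre is within |l| + t/2 of
    l. Using x instead of t/2 makes the bound uniform in t. *)
Lemma min_ch_pow_ge (s x t l : R) : 0 <= s -> 0 <= x -> 0 <= t <= 2 * x ->
  ch_pow s (`|l| + x) <= Num.min (ch_pow s (l + t / 2)) (ch_pow s (l + t / 2 - t)).
Proof.
move=> s0 x0 /andP[t0 tx]; rewrite -[ch_pow _ (l + _)]ch_pow_norm.
rewrite -[ch_pow _ (l + _ - _)]ch_pow_norm (_ : l + t / 2 - t = l - t / 2); last by field.
have t2 : `|t / 2| = t / 2 by rewrite ger0_norm // divr_ge0.
rewrite le_min !ch_pow_le // normr_ge0 /=.
  by apply: le_trans (ler_normB _ _) _; rewrite t2; lra.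
by apply: le_trans (ler_normD _ _) _; rewrite t2; lra.
Qed.

Local Notation mu := (@leb R).

Lemma integral_min_ch_pow_ge (e x t M : R) : 0 <= e -> 0 <= x -> 0 <= t <= 2 * x -> 0 < M ->
  ((2 * (ch_pow e (M + x) * (ch_prim (M + x) - ch_prim x)))%:E
   <= \int[mu]_l (Num.min (ch_pow (2 + e) l) (ch_pow (2 + e) (l - t)))%:E)%E.
Proof.
move=> e0 x0 /andP[t0 tx] M0; set f := ch_pow (2 + e).
have mfs (c : R) : measurable_fun setT (fun l : R => f (l + c)).
  apply: measurableT_comp (measurable_ch_pow _) _; exact: measurable_funD.
pose m l : \bar R := (Num.min (f l) (f (l - t)))%:E.
have mm : measurable_fun setT m.
  by apply/measurable_EFinP; apply: measurable_minr; [exact: measurable_ch_pow|exact: mfs].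
have m0r l : 0 <= Num.min (f l) (f (l - t)) by rewrite le_min !ch_pow_ge0.
have m0 l : (0 <= m l)%E by rewrite lee_fin; exact: m0r.
rewrite -[leRHS](ge0_integral_shift (t / 2) mm m0).
apply: le_trans (integral_ch_pow_shift_ge e0 x0 M0) _.
apply: ge0_le_integral.
- exact: measurableT.
- by move=> l _; rewrite lee_fin; exact: ch_pow_ge0.
- apply/measurable_EFinP; apply: measurableT_comp (measurable_ch_pow _) _.
  by apply: measurable_funD; [exact: normr_measurable|exact: measurable_cst].
- by apply: measurableT_comp mm _; exact: measurable_funD.
move=> l _; rewrite lee_fin; apply: min_ch_pow_ge => //; last by rewrite t0.
exact: addr_ge0.
Qed.
End OneDimensional.

(** * Integrable power tails, used to dominate the angular weight *)

Section Tail.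
Context {R : realType}.
Implicit Types (d a b : R).
Local Notation mu := (@leb R).

Definition tail d a : R := (1 + `|a|) `^ (- (1 + d)).

Lemma norm1_gt0 a : 0 < 1 + `|a|.
Proof. by rewrite ltr_pwDl. Qed.

Lemma tailE d a : tail d a = expR (- (1 + d) * ln (1 + `|a|)).
Proof. by rewrite /tail /powR gt_eqF // norm1_gt0. Qed.

Lemma continuous_tail d : continuous (tail d).
Proof.
move=> x; rewrite (_ : tail d = expR \o ( *%R (- (1 + d))) \o (@ln R) \o (fun a => 1 + `|a|)); last first.
  by apply/funext => y; rewrite tailE.
apply: continuous_comp.
  by apply: continuousD; [exact: cst_continuous|exact: norm_continuous].
apply: continuous_comp; first exact/continuous_ln/norm1_gt0.
apply: continuous_comp; last exact: continuous_expR.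
exact: mulrl_continuous.
Qed.

Definition tail_prim d a : R := - d^-1 * expR (- d * ln (1 + a)).

Lemma is_derive_tail_prim d a : 0 < d -> 0 <= a -> is_derive a 1 (tail_prim d) (tail d a).
Proof.
move=> d0 a0; have a1 : 0 < 1 + a by lra.
have h1 : is_derive a 1 (fun y : R => 1 + y) 1.
  rewrite (_ : (fun y => _) = cst 1 + id); last exact/funext.
  by apply: is_derive_eq; rewrite add0r.
have h2 : is_derive a 1 ((@ln R) \o (fun y => 1 + y)) ((1 + a)^-1).
  by rewrite -[(1 + a)^-1]mulr1; apply: is_derive1_comp; exact: is_derive1_ln.
have h3 := @is_deriveZ _ _ _ _ (- d) _ _ _ h2.
have h4 := @is_derive1_comp _ (@expR R) _ a _ _ (is_derive_expR _) h3.
have h5 := @is_deriveZ _ _ _ _ (- d^-1) _ _ _ h4.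
apply: is_derive_eq h5 _; rewrite tailE (ger0_norm a0) /GRing.scale /=.
rewrite (_ : - (1 + d) * _ = - d * ln (1 + a) - ln (1 + a)); last by ring.
by rewrite expRD expRN lnK ?posrE //; field; rewrite !gt_eqF.
Qed.

Lemma tail_prim_cvg d : 0 < d -> tail_prim d x @[x --> +oo] --> 0.
Proof.
move=> d0.
have lny : (@ln R) (1 + x) @[x --> +oo] --> +oo.
  apply/cvgryPge => A; near=> x.
  rewrite -[A]expRK ler_ln ?posrE ?expR_gt0 //.
  - by rewrite (@le_trans _ _ x) ?lerDr //; near: x; exact: nbhs_pinfty_ge.
  - by rewrite addr_gt0 //; near: x; exact: nbhs_pinfty_gt.
have h : expR (- (d * ln (1 + x))) @[x --> +oo] --> (0 : R).
  apply: (@cvg_comp _ _ _ (fun x => d * ln (1 + x)) (fun z => expR (- z)) _ (pinfty_nbhs R)); last exact: cvgr_expR.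
  exact: gt0_cvgMry.
rewrite -[X in _ --> X](mulr0 (- d^-1)); apply: cvgM; first exact: cvg_cst.
by under eq_fun do rewrite mulNr.
Unshelve. all: by end_near. Qed.

Lemma integral_tail_lty d : 0 < d -> (\int[mu]_a (tail d a)%:E < +oo)%E.
Proof.
move=> d0.
have t0 a : 0 <= tail d a by exact: powR_ge0.
have -> : (\int[mu]_a (tail d a)%:E = \int[@lebesgue_measure R]_a (tail d a)%:E)%E by [].
rewrite (ge0_symfun_integralT t0 (@continuous_tail d)); last first.
  by move=> x; rewrite /tail /= normrN.
rewrite -set_itvcy (@ge0_continuous_FTC2y _ (tail d) (tail_prim d) 0 0).
- by rewrite -EFinB -EFinM ltry.
- by move=> x _; exact: t0.
- exact/continuous_subspaceT/continuous_tail.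
- exact: tail_prim_cvg.
- by move=> x x0; have [] := is_derive_tail_prim d0 (ltW x0).
- apply: cvg_at_right_filter; apply: differentiable_continuous; apply/derivable1_diffP.
  by have [] := is_derive_tail_prim d0 (lexx 0).
- move=> x; rewrite in_itv /= andbT => x0; rewrite derive1E.
  by have [_ ->] := is_derive_tail_prim d0 (ltW x0).
Qed.
End Tail.

(** * Overlap of the kernels cosh^-s *)

Section Kernel.
Context {R : realType}.
Local Notation C := R[i].
Local Notation mu := (@leb R).
Local Notation RM := (measurableTypeR R).
Local Notation mu3 := (leb2 \x mu)%E.
Implicit Types (p q : C * R).

Lemma hcosh_ge1 p q : 0 < p.2 -> 0 < q.2 -> 1 <= hcosh p q.
Proof.
move=> p0 q0; rewrite /hcosh lerDl divr_ge0 ?addr_ge0 ?csq_ge0 ?sqr_ge0 //.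
by rewrite !mulr_ge0 // ltW.
Qed.

Lemma measurable_hcosh p : measurable_fun setT (fun x : RM * RM * RM => hcosh p (hpt x)).
Proof.
pose E (x : RM * RM * RM) : R := expR x.2.
have mE : measurable_fun setT E.
  by apply: measurableT_comp (@measurable_expR R) _; exact: measurable_snd.
have m1 : measurable_fun setT (fun x : RM * RM * RM => x.1.1 : R).
  exact: (measurableT_comp (@measurable_fst _ _ _ _) (@measurable_fst _ _ _ _)).
have m2 : measurable_fun setT (fun x : RM * RM * RM => x.1.2 : R).
  exact: (measurableT_comp (@measurable_snd _ _ _ _) (@measurable_fst _ _ _ _)).
have mEi : measurable_fun setT (fun x : RM * RM * RM => expR (- x.2) : R).
  apply: measurableT_comp (@measurable_expR R) _.
  by apply: measurableT_comp (@oppr_measurable R _) _; exact: measurable_snd.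
rewrite (_ : (fun x : RM * RM * RM => _) = (fun x => 1 + ((complex.Re p.1 - E x * x.1.1) ^+ 2
    + (complex.Im p.1 - E x * x.1.2) ^+ 2 + (p.2 - E x) ^+ 2) * (expR (- x.2) / (2 * p.2)))); last first.
  apply/funext => x; rewrite /hcosh /csq /hpt /=; case: p => -[u v] t /=.
  by rewrite expRN invfM /E; congr (1 + _ * _); rewrite mulrC.
apply: measurable_funD; first exact: measurable_cst.
apply: measurable_funM; last by apply: measurable_funM => //; exact: measurable_cst.
apply: measurable_funD; [apply: measurable_funD|]; apply: measurable_funX;
  apply: measurable_funB; try exact: measurable_cst; rewrite //.
- exact: measurable_funM.
- exact: measurable_funM.
Qed.

Definition hkernel (s : R) p x : R := hcosh p x `^ (- s).

Lemma hkernel_ge0 s p x : 0 <= hkernel s p x.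
Proof. exact: powR_ge0. Qed.

Lemma hmeasurable_hkernel s p : hmeasurable (hkernel s p).
Proof.
rewrite /hmeasurable (_ : _ \o hpt = (@powR R ^~ (- s)) \o (fun y => hcosh p (hpt y))) //.
by apply: measurableT_comp (measurable_hcosh p); exact: measurable_powR.
Qed.

(** This is log(|x| / t) at a point x = (z, t) with z / t = q. *)
Definition radial_shift (q : RM * RM) : R := ln (1 + q.1 ^+ 2 + q.2 ^+ 2) / 2.

Definition radial_weight (s : R) (q : RM * RM) : R := expR (- s * radial_shift q).

Lemma measurable_radial_shift : measurable_fun setT radial_shift.
Proof.
apply: measurable_funM; last exact: measurable_cst.
apply: measurableT_comp (@measurable_ln R) _.
apply: measurable_funD; last by apply: measurable_funX; exact: measurable_snd.
by apply: measurable_funD; [exact: measurable_cst|apply: measurable_funX; exact: measurable_fst].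
Qed.

Lemma measurable_radial_weight s : measurable_fun setT (radial_weight s).
Proof.
apply: measurableT_comp (@measurable_expR R) _.
by apply: measurable_funM; [exact: measurable_cst|exact: measurable_radial_shift].
Qed.

(* On the ray over a fixed ratio z/t, log |x| is a translate of log t, and the distance
   to (0, T) separates into a factor depending on the ray and one depending on log |x|. *)
Lemma hcosh_ray (T : R) (q : RM * RM) (l : R) : 0 < T ->
  hcosh (0, T) (hpt (q, l - radial_shift q)) = expR (radial_shift q) * ch (l - ln T).
Proof.
move=> T0; case: q => a b; rewrite /radial_shift /=.
set W := 1 + _ + _; have W0 : 0 < W by rewrite /W; nra.
set h := expR (ln W / 2); have h2 : h ^+ 2 = W.
  by rewrite /h -expRM_natl mulrC divfK // lnK.
have h0 : 0 < h by exact: expR_gt0.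
rewrite /hcosh /hpt /ch /csq /= opprB !expRD !expRN lnK ?posrE // -/h.
have e0 := expR_gt0 l.
have WE : a ^+ 2 + b ^+ 2 = h ^+ 2 - 1 by rewrite h2 /W; ring.
have -> : (0 - expR l * h^-1 * a) ^+ 2 + (0 - expR l * h^-1 * b) ^+ 2
   = (expR l * h^-1) ^+ 2 * (h ^+ 2 - 1) by rewrite -WE; ring.
by field; rewrite !gt_eqF.
Qed.

Lemma hkernel_ray (s T : R) (q : RM * RM) (l : R) : 0 < T ->
  hkernel s (0, T) (hpt (q, l - radial_shift q)) = radial_weight s q * ch_pow s (l - ln T).
Proof.
move=> T0; rewrite /hkernel hcosh_ray // powRM ?expR_ge0 ?(ltW (ch_gt0 _)) //.
by rewrite /radial_weight [X in X * _]/powR gt_eqF ?expR_gt0 // expRK.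
Qed.

(** Integrals of this kind split into an angular and a one-dimensional factor. The total mass and
    the overlap share the angular factor, so comparing them is a one-dimensional question. *)
Lemma hintegral_ray (F : C * R -> R) (s : R) (m : R -> R) :
  hmeasurable F -> (forall p, 0 <= F p) ->
  measurable_fun setT m -> (forall l, 0 <= m l) ->
  (forall (q : RM * RM) l, F (hpt (q, l - radial_shift q)) = radial_weight s q * m l) ->
  (hintegral F = (\int[leb2]_q (radial_weight s q)%:E) * (\int[mu]_l (m l)%:E))%E.
Proof.
move=> mF F0 mm m0 FE.
have mF' : measurable_fun setT (fun x : RM * RM * RM => (F (hpt x))%:E) by exact/measurable_EFinP.
have F0' (x : RM * RM * RM) : (0 <= (F (hpt x))%:E)%E by rewrite lee_fin; exact: F0.
rewrite /hintegral (fubini_tonelli1 _ mF' F0') /fubini_F.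
have J0 : (0 <= \int[mu]_l (m l)%:E)%E by apply: integral_ge0 => l _; rewrite lee_fin; exact: m0.
rewrite -(@ge0_integralZr _ _ _ _ _ measurableT (fun q : RM * RM => (radial_weight s q)%:E)); last 3 first.
- by apply/measurable_EFinP; exact: measurable_radial_weight.
- by move=> q _; rewrite lee_fin expR_ge0.
- exact: J0.
apply: eq_integral => q _.
have mFq : measurable_fun setT (fun l : RM => (F (hpt (q, l)))%:E).
  by apply: measurableT_comp mF' _; apply: measurable_fun_pair.
rewrite -[LHS](ge0_integral_shift (- radial_shift q) mFq (fun l => F0' (q, l))).
under eq_integral do rewrite FE EFinM.
apply: ge0_integralZl_EFin; rewrite ?expR_ge0 //.
- by move=> l _; rewrite lee_fin; exact: m0.
- exact/measurable_EFinP.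
Qed.
End Kernel.

Section Overlap.
Context {R : realType}.
Local Notation C := R[i].
Local Notation mu := (@leb R).
Local Notation RM := (measurableTypeR R).

(* (1 + |a|)(1 + |b|) <= 2 (1 + a^2 + b^2) *)
Lemma radial_weight_le_tail (d : R) (q : RM * RM) : 0 < d ->
  radial_weight (2 + 2 * d) q <= expR ((1 + d) * ln 2) * (tail d q.1 * tail d q.2).
Proof.
move=> d0; case: q => a b /=; rewrite /radial_weight /radial_shift /= !tailE -!expRD ler_expR.
have A0 := norm1_gt0 a; have B0 := norm1_gt0 b.
have W0 : 0 < 1 + a ^+ 2 + b ^+ 2 by nra.
have : ln (1 + `|a|) + ln (1 + `|b|) <= ln 2 + ln (1 + a ^+ 2 + b ^+ 2).
  rewrite -!lnM ?posrE // ler_ln ?posrE ?mulr_gt0 //.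
  rewrite -(real_normK (num_real a)) -(real_normK (num_real b)).
  by have := normr_ge0 a; have := normr_ge0 b; move: `|a| `|b| => u v;
    have := sqr_ge0 (u - v); have := sqr_ge0 (3 * u - 1); have := sqr_ge0 (3 * v - 1); nra.
move: (ln (1 + `|a|)) (ln (1 + `|b|)) (ln 2) (ln (1 + a ^+ 2 + b ^+ 2)) => A B L W h.
by rewrite (_ : - (2 + 2 * d) * (W / 2) = - (1 + d) * W); [nra|field].
Qed.

(** The weight is (1 + a^2 + b^2)^-(1 + d), integrable over the plane exactly for d > 0. This is why
    the exponent s = 2 + 2d must exceed 2. *)
Lemma integral_radial_weight_lty (d : R) : 0 < d ->
  (\int[leb2]_q (radial_weight (2 + 2 * d) q)%:E < +oo)%E.
Proof.
move=> d0; set c := expR ((1 + d) * ln 2).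
pose f (q : RM * RM) : \bar R := (c * (tail d q.1 * tail d q.2))%:E.
have t0 a : 0 <= tail d a by exact: powR_ge0.
have mt : measurable_fun setT (tail d) by exact: continuous_measurable_fun (@continuous_tail R d).
have mf : measurable_fun setT f.
  apply/measurable_EFinP; apply: measurable_funM; first exact: measurable_cst.
  apply: measurable_funM.
    by apply: (measurableT_comp mt); exact: measurable_fst.
  by apply: (measurableT_comp mt); exact: measurable_snd.
have f0 q : (0 <= f q)%E by rewrite lee_fin !mulr_ge0 ?expR_ge0.
apply: (@le_lt_trans _ _ (\int[leb2]_q f q)%E).
  apply: ge0_le_integral.
  - exact: measurableT.
  - by move=> q _; rewrite lee_fin expR_ge0.
  - by apply/measurable_EFinP; exact: measurable_radial_weight.
  - exact: mf.
  - by move=> q _; rewrite lee_fin; exact: radial_weight_le_tail.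
have -> : (\int[leb2]_q f q = \int[mu \x mu]_q f q)%E by [].
rewrite (fubini_tonelli1 _ mf f0) /fubini_F /f.
pose J := (\int[mu]_a (tail d a)%:E)%E.
have mtE : measurable_fun setT (fun a : RM => (tail d a)%:E) by exact/measurable_EFinP.
have J0 : (0 <= J)%E by apply: integral_ge0 => a _; rewrite lee_fin.
have -> : (\int[mu]_x \int[mu]_y (c * (tail d x * tail d y))%:E = c%:E * (J * J))%E.
  transitivity (\int[mu]_x (c%:E * ((tail d x)%:E * J)))%E.
    apply: eq_integral => x _; under eq_integral do rewrite mulrA EFinM.
    rewrite muleA -EFinM; apply: ge0_integralZl_EFin.
    - exact: measurableT.
    - by move=> y _; rewrite lee_fin.
    - exact: mtE.
    - by rewrite mulr_ge0 ?expR_ge0.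
  have mtJ : measurable_fun setT (fun x : RM => ((tail d x)%:E * J)%E).
    by apply: emeasurable_funM => //; exact: measurable_cst.
  rewrite (@ge0_integralZl_EFin _ _ _ _ _ measurableT (fun x : RM => ((tail d x)%:E * J)%E)); last 3 first.
  - by move=> x _; rewrite mule_ge0 ?lee_fin.
  - exact: mtJ.
  - exact: expR_ge0.
  congr (_ * _)%E; apply: (@ge0_integralZr _ _ _ _ _ measurableT (fun x : RM => (tail d x)%:E)).
  - exact: mtE.
  - by move=> x _; rewrite lee_fin.
  - exact: J0.
have Jlt : (J < +oo)%E by exact: integral_tail_lty.
have Jfin : J \is a fin_num by rewrite ge0_fin_numE.
by rewrite -(fineK Jfin) -!EFinM ltry.
Qed.

Lemma integral_radial_weight_gt0 (s : R) : 0 <= s ->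
  (0 < \int[leb2]_q (radial_weight s q)%:E)%E.
Proof.
move=> s0; pose I : set RM := `[0%R, 1%R].
have mI : measurable I by exact: measurable_itv.
pose c := expR (- s * (ln 3 / 2)).
apply: (@lt_le_trans _ _ (\int[leb2]_(q in I `*` I) c%:E)%E).
  rewrite integral_cst /=; last exact: measurableX.
  rewrite /leb2 product_measure1E // /I /leb /= !lebesgue_measure_itv /= lte_fin ltr01.
  by rewrite -!EFinB -!EFinM lte_fin !subr0 !mulr1 expR_gt0.
have mw : measurable_fun setT (fun q : RM * RM => (radial_weight s q)%:E).
  by apply/measurable_EFinP; exact: measurable_radial_weight.
apply: (@le_trans _ _ (\int[leb2]_(q in I `*` I) (radial_weight s q)%:E)%E).
  apply: ge0_le_integral.
  - exact: measurableX.
  - by move=> q _; rewrite lee_fin expR_ge0.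
  - exact: measurable_cst.
  - by apply: measurable_funTS.
  - move=> [a b] /= []; rewrite /I /= !in_itv /= => /andP[a0 a1] /andP[b0 b1].
    rewrite lee_fin ler_expR !mulNr lerN2 ler_wpM2l // ler_pM2r ?invr_gt0 //.
    by rewrite /= ler_ln ?posrE //; nra.
apply: ge0_subset_integral.
- exact: measurableX.
- exact: measurableT.
- exact: mw.
- by move=> q _; rewrite lee_fin expR_ge0.
- by [].
Qed.

(* The bound 2 / (1 + T1) is the overlap of the visual measures of two points at
   distance ln T1, i.e. of the limit s -> 2. *)
Lemma hkernel_overlap (T1 theta : R) : 1 <= T1 -> 0 <= theta -> theta < 2 / (1 + T1) ->
  exists s Z : R, [/\ 0 < Z, (hintegral (hkernel s (0, 1)%R) <= Z%:E)%E &
    forall T, 1 <= T <= T1 ->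
    ((theta * Z)%:E <= hintegral (fun x => Num.min (hkernel s (0, 1) x) (hkernel s (0, T) x))%R)%E].
Proof.
move=> T11 th0 thT.
have T10 : 0 < T1 by lra.
(* Half the largest distance allowed: with it, -[ch_prim x] is exactly the limiting overlap 2 / (1 +
   T1). *)
pose x := ln T1 / 2.
have x0 : 0 <= x by rewrite divr_ge0 // ln_ge0.
have x2 : 2 * x = ln T1 by rewrite /x; field.
have px : ch_prim x = - (2 / (1 + T1)).
  by rewrite /ch_prim x2 lnK ?posrE // mulNr.
have [M [M0 hM]] : exists M, 0 < M /\ theta < ch_prim (M + x) - ch_prim x.
  have e0 : 0 < 2 / (1 + T1) - theta by rewrite subr_gt0.
  have [A [_ hA]] := (cvgr0Pnorm_lt _).1 (@ch_prim_cvg R) _ e0.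
  have M0 : 0 < `|A| + 1 by rewrite ltr_wpDl.
  exists (`|A| + 1); split => //; have /hA : A < `|A| + 1 + x by have := ler_norm A; lra.
  by rewrite ltr_norml => /andP[h _]; rewrite px; lra.
set g := ch_prim (M + x) - ch_prim x in hM.
have [d [d0 hd]] : exists d, 0 < d /\ theta <= ch_pow (2 * d) (M + x) * g.
  pose L := ln (ch (M + x)); have L0 : 0 <= L by rewrite ln_ge0 // ch_ge1.
  have gt : 0 < g - theta by rewrite subr_gt0.
  have g0 : 0 < g by exact: le_lt_trans hM.
  (* Chosen so that 2d(L + 1)g = g - theta. Then expR(-2dL) >= 1 - 2dL keeps the product with g
     above theta; the 1 added to L avoids a division by zero. *)
  exists ((g - theta) / (2 * (L + 1) * g)).
  have D0 : 0 < 2 * (L + 1) * g by rewrite !mulr_gt0 //; lra.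
  split; first by rewrite divr_gt0.
  set d := _ / _; have dE : 2 * d * (L + 1) * g = g - theta.
    by rewrite /d; field; rewrite gt_eqF //= gt_eqF //; lra.
  have d0 : 0 < d by rewrite divr_gt0.
  rewrite ch_powE -/L; have := expR_ge1Dx (- (2 * d) * L) => h.
  apply: (@le_trans _ _ ((1 - 2 * d * L) * g)).
    rewrite (_ : (1 - 2 * d * L) * g = g - 2 * d * (L + 1) * g + 2 * d * g); last by ring.
    by rewrite dE; have := mulr_gt0 d0 g0; lra.
  by rewrite ler_pM2r //; move: h; rewrite mulNr; lra.
pose s := 2 + 2 * d; pose Zw := (\int[leb2]_q (radial_weight s q)%:E)%E.
have s0 : 0 <= s by rewrite /s; lra.
have Z0 : (0 < Zw)%E by exact: integral_radial_weight_gt0.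
have Zfin : Zw \is a fin_num.
  by rewrite ge0_fin_numE ?(ltW Z0) //; exact: integral_radial_weight_lty.
(* Twice the angular factor bounds the mass, as the integral of ch^-s is at most 2. Neither [s] nor
   [Z] depends on [T]. *)
exists s, (2 * fine Zw); split.
- by rewrite mulr_gt0 // fine_gt0 // Z0 /= -ge0_fin_numE ?(ltW Z0).
- have kE (q : RM * RM) l : hkernel s (0, 1) (hpt (q, l - radial_shift q)) = radial_weight s q * ch_pow s l.
    by rewrite (hkernel_ray s q l ltr01) ln1 subr0.
  rewrite (hintegral_ray (@hmeasurable_hkernel R s _) (hkernel_ge0 s _) (measurable_ch_pow s) (ch_pow_ge0 s) kE).
  rewrite mulrC EFinM fineK // lee_pmul2l //.
  by apply: integral_ch_pow_le; rewrite /s; lra.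
- move=> T /andP[T0 T1T].
  have T00 : 0 < T by lra.
  pose m l := Num.min (ch_pow s l) (ch_pow s (l - ln T)).
  have kE (q : RM * RM) l : Num.min (hkernel s (0, 1) (hpt (q, l - radial_shift q)))
      (hkernel s (0, T) (hpt (q, l - radial_shift q))) = radial_weight s q * m l.
    by rewrite (hkernel_ray s q l ltr01) (hkernel_ray s q l T00) ln1 subr0 /m minr_pMr // expR_ge0.
  have mm : measurable_fun setT m.
    apply: measurable_minr; first exact: measurable_ch_pow.
    apply: measurableT_comp (measurable_ch_pow _) _.
    by apply: measurable_funD; [exact: measurable_id|exact: measurable_cst].
  have m0 l : 0 <= m l by rewrite le_min !ch_pow_ge0.
  have mK : hmeasurable (fun x => Num.min (hkernel s (0, 1) x) (hkernel s (0, T) x)).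
    by apply: measurable_minr; exact: hmeasurable_hkernel.
  have K0 y : 0 <= Num.min (hkernel s (0, 1) y) (hkernel s (0, T) y).
    by rewrite le_min !hkernel_ge0.
  rewrite (hintegral_ray mK K0 mm m0 kE).
  rewrite (_ : theta * (2 * fine Zw) = fine Zw * (2 * theta)); last by ring.
  rewrite EFinM fineK // lee_pmul2l //.
  have T2x : 0 <= ln T <= 2 * x.
    by rewrite ln_ge0 //= x2 ler_ln.
  have d20 : 0 <= 2 * d by lra.
  apply: le_trans (integral_min_ch_pow_ge d20 x0 T2x M0).
  by rewrite lee_fin ler_pM2l.
Qed.
End Overlap.

(** * Reduced words *)

Section ReducedWords.
Variable n : nat.
Implicit Types (x y z : 'I_n * bool) (w : seq ('I_n * bool)).

Definition linv x : 'I_n * bool := (x.1, ~~ x.2).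

Lemma linvK : involutive linv.
Proof. by case=> i t; rewrite /linv /= negbK. Qed.

Lemma linv_eq x y : (linv x == linv y) = (x == y).
Proof. by apply/eqP/eqP => [/(can_inj linvK)|->]. Qed.

Definition head_is x w := ohead w == Some x.

Lemma reduced_cons x w : reduced (x :: w) = ~~ head_is (linv x) w && reduced w.
Proof.
case: w => [|y w] //=; rewrite /reduced /= /head_is /=; congr (~~ _ && _).
apply/idP/eqP => [/andP[/eqP h1 h2]|[->]].
  by congr Some; apply/eqP; rewrite -pair_eqE /= /linv /= h1 eqxx; move: h2; case: x.2; case: y.2.
by rewrite /linv /= eqxx; case: x.2.
Qed.

(** The action of the free group on its normal forms: left multiplication by a letter, followed by
    the only cancellation that can occur. *)
Definition lmul x w := if head_is (linv x) w then behead w else x :: w.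

Lemma reduced_behead w : reduced w -> reduced (behead w).
Proof. by case: w => [|x w] //; rewrite reduced_cons => /andP[]. Qed.

Lemma lmul_reduced x w : reduced w -> reduced (lmul x w).
Proof.
move=> rw; rewrite /lmul; case: ifP => [_|h]; first exact: reduced_behead.
by rewrite reduced_cons h rw.
Qed.

Lemma lmulK x w : reduced w -> lmul (linv x) (lmul x w) = w.
Proof.
move=> rw; rewrite {2}/lmul; case: ifP => h; last by rewrite /lmul linvK /head_is /= eqxx.
case: w rw h => [|y w] //; rewrite reduced_cons /head_is /= => /andP[h _] /eqP[E].
by rewrite /lmul linvK /head_is -[X in ohead w == Some X]linvK -E (negbTE h).
Qed.

Lemma lmulVK x w : reduced w -> lmul x (lmul (linv x) w) = w.
Proof. by rewrite -{1}[x]linvK; apply: lmulK. Qed.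

Lemma lmul_cons x w : reduced (x :: w) -> lmul x w = x :: w.
Proof. by rewrite reduced_cons /lmul => /andP[/negbTE ->]. Qed.

Lemma head_lmul x w : reduced w -> head_is x (lmul x w) = ~~ head_is (linv x) w.
Proof.
move=> rw; rewrite /lmul; case: ifP => h; last by rewrite /head_is /= eqxx.
case: w rw h => [|y w] //; rewrite reduced_cons /head_is /= => /andP[h _] /eqP[E].
by move: h; rewrite E linvK; apply: negbTE.
Qed.

Definition head2_is x y w := take 2 w == [:: x; y].

(** If [w] does not start with x, then x^-1 w starts with x^-1, and this letter must not be mistaken
    for y; hence the condition [y != linv x]. *)
Lemma head2_lmul x y w : y != linv x -> reduced w ->
  head2_is x y w = head_is y (lmul (linv x) w).
Proof.
move=> yx rw; rewrite /lmul linvK /head2_is; case: ifP => [|h].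
  case: w rw => [|z [|u w]] //= _; rewrite /head_is /= => /eqP[->].
    by rewrite eqseq_cons eqxx.
  by rewrite !eqseq_cons eqxx take0 /= andbT; apply/eqP/eqP => [->|[]].
rewrite [RHS]/head_is /= (inj_eq Some_inj) [linv x == y]eq_sym (negbTE yx).
case: w rw h => [|z [|u w]] //= _; rewrite /head_is /= (inj_eq Some_inj) => h.
  by rewrite eqseq_cons h.
by rewrite !eqseq_cons h.
Qed.

Definition lconj x y w := lmul x (lmul y (lmul (linv x) w)).

Lemma lconj_reduced x y w : reduced w -> reduced (lconj x y w).
Proof. by move=> rw; do !apply: lmul_reduced. Qed.

Lemma lconjK x y w : reduced w -> lconj x (linv y) (lconj x y w) = w.
Proof.
by move=> rw; rewrite /lconj lmulK ?lmulK ?lmulVK //; do !apply: lmul_reduced.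
Qed.

Lemma lconjVK x y w : reduced w -> lconj x y (lconj x (linv y) w) = w.
Proof. by rewrite -{1}[y]linvK; apply: lconjK. Qed.

(** The word x y x^-1 w starts with x y exactly when y x^-1 w starts with y, that is, when x^-1 w
    does not start with y^-1, that is, when w does not start with x y^-1. The last equivalence needs
    y^-1 to differ from x^-1. *)
Lemma head2_lconj x y w : y != x -> y != linv x -> reduced w ->
  head2_is x y (lconj x y w) = ~~ head2_is x (linv y) w.
Proof.
move=> yx yx' rw; rewrite head2_lmul ?lconj_reduced // /lconj.
rewrite lmulK ?head_lmul ?head2_lmul ?linv_eq //; by do ?apply: lmul_reduced.
Qed.

End ReducedWords.

(** * Evaluation of words in SL(2,C) *)

Section FreeGroupAction.
Variables (R : realType) (n : nat) (xi : 'I_n -> 'M[R[i]]_2).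
Hypothesis det_xi : forall i, \det (xi i) = 1.
Implicit Types (x y : 'I_n * bool) (w : seq ('I_n * bool)).

Definition lgen x := gen xi x.1 x.2.

Lemma det_lgen x : \det (lgen x) = 1.
Proof. by case: x => i [] /=; rewrite /lgen /gen /= ?det_inv det_xi ?invr1. Qed.

Lemma lgenV x : lgen x * lgen (linv x) = 1.
Proof.
have u i : xi i \in unitmx by rewrite unitmxE det_xi unitr1.
by case: x => i []; rewrite /lgen /gen /= -[_ * _]/(_ *m _) ?mulmxV ?mulVmx.
Qed.

Lemma word_eval_cons x w : word_eval xi (x :: w) = lgen x * word_eval xi w.
Proof. by rewrite /word_eval big_cons. Qed.

Lemma det_word_eval w : \det (word_eval xi w) = 1.
Proof.
elim: w => [|x w IH]; first by rewrite /word_eval big_nil det1.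
by rewrite word_eval_cons det_mulmx det_lgen IH mulr1.
Qed.

Lemma word_eval_cat w w' : word_eval xi (w ++ w') = word_eval xi w * word_eval xi w'.
Proof. by rewrite /word_eval big_cat. Qed.

Lemma word_eval_lmul x w : word_eval xi (lmul x w) = lgen x * word_eval xi w.
Proof.
rewrite /lmul; case: ifP => [|_]; last exact: word_eval_cons.
case: w => [|y w] //; rewrite /head_is /= => /eqP[->].
by rewrite word_eval_cons mulrA lgenV mul1r.
Qed.

Definition cgen x y := lgen x * lgen y * lgen (linv x).

Lemma det_cgen x y : \det (cgen x y) = 1.
Proof. by rewrite /cgen !det_mulmx !det_lgen !mulr1. Qed.

Lemma word_eval_lconj x y w : word_eval xi (lconj x y w) = cgen x y * word_eval xi w.
Proof. by rewrite /lconj !word_eval_lmul /cgen !mulrA. Qed.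

Definition winv w := rev (map (@linv n) w).

Lemma word_eval_winv w : word_eval xi (winv w) * word_eval xi w = 1.
Proof.
elim: w => [|x w IH]; first by rewrite /word_eval /winv !big_nil mulr1.
rewrite /winv /= rev_cons -cats1 word_eval_cat !word_eval_cons.
rewrite {2}/word_eval big_nil mulr1 mulrA -[_ * _ * lgen x]mulrA.
by rewrite -{2}[x]linvK lgenV mulr1.
Qed.

Hypothesis free_xi : freely_generating xi.

(** Multiplying [winv w] into [w'] letter by letter gives a reduced word whose value is 1 or -1.
    Freeness makes it empty, and multiplying back by [w] recovers [w']. *)
Lemma word_eval_inj_pm1 w w' : reduced w -> reduced w' ->
  is_pm1 (word_eval xi (winv w) * word_eval xi w') -> w = w'.
Proof.
move=> rw rw' h.
pose lm u v : seq ('I_n * bool) := foldr (@lmul n) v u.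
have lm_red u v : reduced v -> reduced (lm u v).
  by move=> rv; elim: u => //= z u; apply: lmul_reduced.
have lm_eval u v : word_eval xi (lm u v) = word_eval xi u * word_eval xi v.
  elim: u => [|z u IH] /=; first by rewrite /word_eval big_nil mul1r.
  by rewrite word_eval_lmul IH word_eval_cons mulrA.
have lm_nil u : reduced u -> lm u [::] = u.
  by elim: u => //= z u IH ru; rewrite IH ?lmul_cons //; exact: (@reduced_behead _ (z :: u)).
have lmK u v : reduced v -> lm u (lm (winv u) v) = v.
  elim: u v => // z u IH v rv; rewrite /winv /= rev_cons -cats1 /lm foldr_cat /=.
  rewrite -[foldr _ _ (rev _)]/(lm (winv u) _) -[foldr _ _ u]/(lm u _) IH ?lmul_reduced //.
  by rewrite lmulVK.
rewrite -[RHS](lmK w w' rw').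
case E : (lm (winv w) w') => [|z u]; first by rewrite lm_nil.
have /free_xi : reduced (lm (winv w) w') by exact: lm_red.
by rewrite lm_eval E => /(_ isT).
Qed.

End FreeGroupAction.

(** * Finiteness of orbits in balls *)

Section MatrixNorm.
Variable R : realType.
Local Notation C := R[i].
Implicit Types (g h : 'M[C]_2).

Lemma mxnsqE g : mxnsq g = csq (g 0 0) + csq (g 0 1) + csq (g 1 0) + csq (g 1 1).
Proof.
rewrite /mxnsq !big_ord_recl !big_ord0 /= !addr0 (_ : lift ord0 ord0 = 1); last exact/val_inj.
by rewrite !addrA.
Qed.

Lemma mxnsq_ge0 g : 0 <= mxnsq g.
Proof. by rewrite mxnsqE; do ?[exact: csq_ge0 | apply: addr_ge0]. Qed.

Lemma mxnsqN g : mxnsq (- g) = mxnsq g.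
Proof.
have csqN (z : C) : csq (- z) = csq z by case: z => ? ?; rewrite /csq /=; ring.
by rewrite !mxnsqE !mxE !csqN.
Qed.

Lemma csqD_le (z w : C) : csq (z + w) <= 2 * (csq z + csq w).
Proof.
case: z w => [a b] [c d]; rewrite /csq /= -subr_ge0.
rewrite (_ : _ - _ = (a - c) ^+ 2 + (b - d) ^+ 2); last by ring.
by rewrite addr_ge0 ?sqr_ge0.
Qed.

Lemma mxnsqM_le g h : mxnsq (g * h) <= 2 * mxnsq g * mxnsq h.
Proof.
rewrite [g]mx2_eta [h]mx2_eta mulmx2 !mxnsqE !mx2E.
move: (g 0 0) (g 0 1) (g 1 0) (g 1 1) (h 0 0) (h 0 1) (h 1 0) (h 1 1) => a b c d e f u v.
apply: (@le_trans _ _ (2 * (csq (a * e) + csq (b * u)) + 2 * (csq (a * f) + csq (b * v))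
  + 2 * (csq (c * e) + csq (d * u)) + 2 * (csq (c * f) + csq (d * v)))).
  by rewrite !lerD // csqD_le.
rewrite !csqM; move: (csq_ge0 a) (csq_ge0 b) (csq_ge0 c) (csq_ge0 d) (csq_ge0 e) (csq_ge0 f) (csq_ge0 u) (csq_ge0 v).
move: (csq a) (csq b) (csq c) (csq d) (csq e) (csq f) (csq u) (csq v).
move=> {}a {}b {}c {}d {}e {}f {}u {}v a0 b0 c0 d0 e0 f0 u0 v0.
rewrite -subr_ge0 (_ : _ - _ = 2 * (a * u + a * v + b * e + b * f + c * u + c * v + d * e + d * f)); last by ring.
by rewrite mulr_ge0 // !addr_ge0 // mulr_ge0.
Qed.

Lemma mxnsq_invmx g : \det g = 1 -> mxnsq (invmx g) = mxnsq g.
Proof.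
move=> /det1_mx2 h; have -> : invmx g = mx2 (g 1 1) (- g 0 1) (- g 1 0) (g 0 0).
  by rewrite {1}[g]mx2_eta invmx2.
rewrite !mxnsqE !mx2E /csq.
by case: (g 0 0) (g 0 1) (g 1 0) (g 1 1) => [? ?] [? ?] [? ?] [? ?] /=; ring.
Qed.

Definition coord g (e : 'I_2 * 'I_2 * bool) : R :=
  if e.2 then complex.Re (g e.1.1 e.1.2) else complex.Im (g e.1.1 e.1.2).

Lemma mxnsq_coord g : mxnsq g = \sum_e coord g e ^+ 2.
Proof.
rewrite mxnsqE -(pair_bigA _ (fun ij b => coord g (ij, b) ^+ 2)) /=.
rewrite -(pair_bigA _ (fun i j => \sum_b coord g ((i, j), b) ^+ 2)) /=.
rewrite !big_ord_recl !big_ord0 /= !addr0 (_ : lift ord0 ord0 = 1); last exact/val_inj.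
by rewrite !big_bool /coord /= /csq; ring.
Qed.

(** Pigeonhole on a grid of side [r] in the eight real coordinates: matrices in one cell are at
    squared distance at most 8 r^2 < d, and a bounded set meets finitely many cells. *)
Lemma finite_separated (T : Type) (S : set T) (f : T -> 'M[C]_2) (B d : R) : 0 < d ->
  (forall w, S w -> mxnsq (f w) <= B) ->
  (forall w w', S w -> S w' -> mxnsq (f w - f w') < d -> w = w') ->
  finite_set S.
Proof.
move=> d0 hB hS; pose r : R := Num.min 1 (d / 16).
have r0 : 0 < r by rewrite lt_min ltr01 divr_gt0.
have r8 : r ^+ 2 *+ 8 < d.
  have r1 : r <= 1 by rewrite ge_min lexx.
  have rd : r <= d / 16 by rewrite ge_min lexx orbT.
  rewrite -mulr_natr; nra.
(* A coordinate has square at most B, hence absolute value at most |B| + 1. The shift makes it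
   nonnegative, where truncation is the floor. *)
have cB w e : S w -> 0 <= coord (f w) e + (`|B| + 1) <= 2 * (`|B| + 1).
  move=> Sw; have : coord (f w) e ^+ 2 <= B.
    apply: le_trans (hB w Sw); rewrite mxnsq_coord (bigD1 e) //= lerDl.
    by apply: sumr_ge0 => ? _; exact: sqr_ge0.
  by have := ler_norm B; nra.
pose N := Num.truncn (2 * (`|B| + 1) / r).
pose k w e : nat := Num.truncn ((coord (f w) e + (`|B| + 1)) / r).
have kN w e : S w -> (k w e < N.+1)%N.
  move=> Sw; rewrite ltnS le_truncn // ler_pM2r ?invr_gt0 //.
  by have /andP[] := cB w e Sw.
pose key w : {ffun 'I_2 * 'I_2 * bool -> 'I_N.+1} := [ffun e => inord (k w e)].
have inj_key : {in S &, injective key}.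
  move=> w w'; rewrite !inE => Sw Sw' E; apply: hS => //.
  apply: le_lt_trans r8; rewrite mxnsq_coord.
  rewrite (_ : r ^+ 2 *+ 8 = \sum_(e : 'I_2 * 'I_2 * bool) r ^+ 2); last first.
    by rewrite sumr_const !card_prod !card_ord card_bool.
  apply: ler_sum => e _.
  have kE : k w e = k w' e.
    have := congr1 val (congr1 (fun g : {ffun _ -> _} => g e) E).
    by rewrite /= !ffunE !inordK ?kN.
  have -> : coord (f w - f w') e = coord (f w) e - coord (f w') e.
    by rewrite /coord !mxE; case: e.2; rewrite raddfB.
  have /andP[c0 _] := cB w e Sw; have /andP[c0' _] := cB w' e Sw'.
  have := truncn_itv (divr_ge0 c0 (ltW r0)); have := truncn_itv (divr_ge0 c0' (ltW r0)).
  rewrite -!/(k _ _) kE -natr1 !ler_pdivlMr // !ltr_pdivrMr //.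
  move: (k w' e)%:R => K /andP[h1 h2] /andP[h3 h4].
  by rewrite -subr_ge0 subr_sqr mulr_ge0 //; lra.
have /eq_finite_set <- := inj_card_eq inj_key.
exact: finite_finset.
Qed.
End MatrixNorm.

Section OrbitFinite.
Variables (R : realType) (n : nat) (xi : 'I_n -> 'M[R[i]]_2).
Hypothesis det_xi : forall i, \det (xi i) = 1.
Hypothesis free_xi : freely_generating xi.
Hypothesis kleinian_xi : kleinian xi.

Lemma hcoshC (p q : R[i] * R) : hcosh p q = hcosh q p.
Proof.
rewrite /hcosh -(opprB q.1 p.1) -(opprB q.2 p.2) sqrrN mulrAC.
by congr (1 + (_ + _) / _); case: (q.1 - p.1) => ? ?; rewrite /csq /=; ring.
Qed.

(** Once p and q are moved to the base point, the words become matrices [m w] of bounded norm. If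
    two of these are close, w^-1 w' is close to 1, so discreteness makes it 1 or -1 and freeness
    gives w = w'. *)
Lemma finite_orbit (p q : R[i] * R) (M : R) : 0 < p.2 -> 0 < q.2 ->
  finite_set [set w | reduced w /\ hcosh (mob_act (word_eval xi w) p) q <= M].
Proof.
move=> p0 q0; have [gp [gp1 gpE]] := base_transitive p0.
have [gq [gq1 gqE]] := base_transitive q0.
have [eps [eps0 disc]] := kleinian_xi.
have up : gp \in unitmx by rewrite unitmxE gp1 unitr1.
have uq : gq \in unitmx by rewrite unitmxE gq1 unitr1.
have gpi1 : \det (invmx gp) = 1 by rewrite det_inv gp1 invr1.
have gpi : mob_act (invmx gp) (0, 1) = p.
  by rewrite -gpE -mob_actM // -[_ * _]/(_ *m _) mulVmx // mob_act1.
pose m w := gq * word_eval xi w * invmx gp.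
have m1 w : \det (m w) = 1 by rewrite /m !det_mulmx gq1 gpi1 det_word_eval // !mulr1.
have mE w : mxnsq (m w) = 2 * hcosh (mob_act (word_eval xi w) p) q.
  have w1 := det_word_eval det_xi w.
  rewrite -[RHS](_ : 2 * hcosh (mob_act gq (mob_act (word_eval xi w) p)) (mob_act gq q) = _); last first.
    by rewrite hcosh_mob_act ?mob_act_gt0.
  have gqw1 : \det (gq * word_eval xi w) = 1 by rewrite det_mulmx gq1 w1 mulr1.
  have e0 : 0 < ((0, 1) : R[i] * R).2 by [].
  rewrite gqE -mob_actM // -{1}gpi -mob_actM // -/(m w) hcoshC hcosh_base_mob_act //.
  by rewrite mulrC divfK.
(* The constants produced by [mxnsqM_le] on w^-1 w' - 1 = a mi (m w' - m w) gp, where a = gp^-1 and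
   mi = (m w)^-1 has squared norm at most 2|M|. The added 1 makes [c] positive. *)
pose c := 2 * (2 * (2 * mxnsq (invmx gp) * (2 * `|M|))) * mxnsq gp + 1.
have c0 : 0 < c.
  by rewrite ltr_wpDl // !mulr_ge0 ?mxnsq_ge0.
apply: (@finite_separated _ _ _ m (2 * M) (eps / c)).
- by rewrite divr_gt0.
- by move=> w [_ hw]; rewrite mE ler_pM2l.
move=> w w' [rw hw] [rw' hw'] close.
apply: (word_eval_inj_pm1 det_xi free_xi rw rw').
rewrite -word_eval_cat; apply: disc; first by exists (winv w ++ w').
left; rewrite word_eval_cat.
set a := invmx gp in m m1 mE gpi gpi1 c c0 close *; pose b := invmx gq.
set vi := word_eval xi (winv w).
have viv : vi * word_eval xi w = 1 by exact: word_eval_winv.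
have agp : a * gp = 1 by exact: mulVmx.
have gpa : gp * a = 1 by exact: mulmxV.
have bgq : b * gq = 1 by exact: mulVmx.
pose mi := gp * vi * b.
have mim : mi * m w = 1.
  by rewrite /mi /m !mulrA -(mulrA _ b gq) bgq mulr1 -(mulrA gp vi) viv mulr1.
have miE : mi = invmx (m w).
  have um : m w \in unitmx by rewrite unitmxE m1 unitr1.
  by rewrite -[LHS](mulmxK um) -[mi *m _]/(mi * m w) mim -[1]/(1%:M) mul1mx.
have key u : a * mi * (gq * u * a) * gp = vi * u.
  rewrite /mi !mulrA agp mul1r -(mulrA vi b gq) bgq mulr1.
  by rewrite -(mulrA (vi * u) a gp) agp mulr1.
have -> : vi * word_eval xi w' - 1 = a * mi * (m w' - m w) * gp.
  by rewrite mulrBr mulrBl !key viv.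
have Mw : mxnsq mi <= 2 * `|M|.
  by rewrite miE mxnsq_invmx // mE ler_pM2l // (le_trans hw) // ler_norm.
set D := m w' - m w.
have close' : mxnsq D < eps / c by rewrite -mxnsqN /D opprB.
apply: (@le_lt_trans _ _ ((c - 1) * mxnsq D)).
  have gp0 := mxnsq_ge0 gp; have D0 := mxnsq_ge0 D; have a0 := mxnsq_ge0 a.
  apply: le_trans (mxnsqM_le _ _) _.
  apply: (@le_trans _ _ (2 * (2 * mxnsq (a * mi) * mxnsq D) * mxnsq gp)).
    by rewrite ler_wpM2r // ler_wpM2l // mxnsqM_le.
  rewrite /c addrK (_ : 2 * (2 * (2 * mxnsq a * (2 * `|M|))) * mxnsq gp * mxnsq D
    = 2 * (2 * (2 * mxnsq a * (2 * `|M|)) * mxnsq D) * mxnsq gp); last by ring.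
  rewrite ler_wpM2r // ler_wpM2l // ler_wpM2r // ler_wpM2l //.
  apply: le_trans (mxnsqM_le _ _) _.
  by rewrite ler_wpM2l // mulr_ge0.
apply: (@le_lt_trans _ _ (c * mxnsq D)).
  by rewrite ler_wpM2r ?mxnsq_ge0 // lerBlDr lerDl.
by rewrite mulrC -ltr_pdivlMr.
Qed.
End OrbitFinite.

(** * Almost nearest orbit points *)

Section Voronoi.
Variables (R : realType) (n : nat) (xi : 'I_n -> 'M[R[i]]_2).
Hypothesis det_xi : forall i, \det (xi i) = 1.
Hypothesis free_xi : freely_generating xi.
Hypothesis kleinian_xi : kleinian xi.
Variable p : R[i] * R.
Hypothesis p_gt0 : 0 < p.2.
Local Notation RM := (measurableTypeR R).
Implicit Types (x y : 'I_n * bool) (w : seq ('I_n * bool)) (q : R[i] * R).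
Implicit Types (A : pred (seq ('I_n * bool))).

Definition orbit_cosh w q : R := hcosh (mob_act (word_eval xi w) p) q.

(* The tolerance 1 guarantees that the set of nearest orbit points is nonempty
   without having to attain an infimum. *)
Definition nearest q w : Prop :=
  reduced w /\ forall w', reduced w' -> orbit_cosh w q <= 1 + orbit_cosh w' q.

Lemma finite_nearest q : 0 < q.2 -> finite_set [set w | nearest q w].
Proof.
move=> q0; apply: sub_finite_set
  (finite_orbit det_xi free_xi kleinian_xi (1 + orbit_cosh [::] q) p_gt0 q0).
by move=> w [rw hw]; split => //; exact: hw.
Qed.

(** Descent: a word that is not almost nearest is beaten by more than 1, so an integer bound on its
    cosh drops with each replacement. Since cosh is at least 1, this stops. *)
Lemma exists_nearest q : 0 < q.2 -> exists w, nearest q w.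
Proof.
move=> q0; suff H (k : nat) w : reduced w -> orbit_cosh w q < k%:R -> exists w, nearest q w.
  by apply: (H (Num.truncn (orbit_cosh [::] q)).+1 [::]) => //; exact: truncnS_gt.
elim: k w => [|k IH] w rw hw.
  have := hcosh_ge1 (mob_act_gt0 (det_word_eval det_xi w) p_gt0) q0.
  by rewrite -/(orbit_cosh w q); lra.
case: (pselect (nearest q w)) => [|nw]; first by exists w.
case: (pselect (exists w', reduced w' /\ 1 + orbit_cosh w' q < orbit_cosh w q)) => [[w' [rw' h]]|h].
  by apply: (IH w' rw'); move: hw; rewrite -natr1; lra.
case: nw; split => // w' rw'; rewrite leNgt; apply/negP => h'.
by apply: h; exists w'.
Qed.

Lemma orbit_cosh_lconj x y w q : 0 < q.2 ->
  orbit_cosh (lconj x y w) (mob_act (cgen xi x y) q) = orbit_cosh w q.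
Proof.
move=> q0; have w1 := det_word_eval det_xi w; have g1 := det_cgen det_xi x y.
by rewrite /orbit_cosh word_eval_lconj // mob_actM // hcosh_mob_act // mob_act_gt0.
Qed.

Lemma nearest_lconj x y w q : 0 < q.2 -> reduced w ->
  nearest (mob_act (cgen xi x y) q) (lconj x y w) <-> nearest q w.
Proof.
move=> q0 rw; split=> [[_ h]|[_ h]]; split=> //; first 1 last.
- exact: lconj_reduced.
- move=> w' rw'; rewrite orbit_cosh_lconj // -(lconjVK x y rw') orbit_cosh_lconj //.
  by apply: h; exact: lconj_reduced.
- move=> w' rw'; rewrite -(orbit_cosh_lconj x y w q0) -(orbit_cosh_lconj x y w' q0).
  by apply: h; exact: lconj_reduced.
Qed.

(** [fset_set] is empty on infinite sets, so the intended set is obtained through [finite_nearest],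
    at points of positive height. *)
Definition voronoi q : seq (seq ('I_n * bool)) := fset_set [set w | nearest q w].

Lemma mem_voronoi q w : 0 < q.2 -> w \in voronoi q <-> nearest q w.
Proof.
move=> q0; have := in_fset_set (finite_nearest q0) => /(_ w) E.
by split=> [h|h]; [move: E h => /= -> /set_mem|rewrite -[_ \in _]/(w \in fset_set _) E mem_set].
Qed.

Lemma uniq_voronoi q : uniq (voronoi q).
Proof. exact: fset_uniq. Qed.

Lemma voronoi_reduced q w : 0 < q.2 -> w \in voronoi q -> reduced w.
Proof. by move=> q0 /(mem_voronoi _ q0)[]. Qed.

Lemma voronoi_size_gt0 q : 0 < q.2 -> (0 < size (voronoi q))%N.
Proof.
move=> q0; have [w /(mem_voronoi _ q0)] := exists_nearest q0.
by case: (voronoi q).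
Qed.

Lemma voronoi_lconj x y q : 0 < q.2 ->
  perm_eq (voronoi (mob_act (cgen xi x y) q)) (map (lconj x y) (voronoi q)).
Proof.
move=> q0; have gq0 := mob_act_gt0 (det_cgen det_xi x y) q0.
apply: uniq_perm; first exact: uniq_voronoi.
  rewrite map_inj_in_uniq ?uniq_voronoi // => w w' hw hw' E.
  by rewrite -(lconjK x y (voronoi_reduced q0 hw)) E (lconjK x y (voronoi_reduced q0 hw')).
move=> w; apply/idP/mapP => [hw|[w' hw' ->]].
  have rw := voronoi_reduced gq0 hw.
  exists (lconj x (linv y) w); last by rewrite lconjVK.
  apply/(mem_voronoi _ q0); apply/(nearest_lconj x y q0); first exact: lconj_reduced.
  by rewrite lconjVK //; apply/(mem_voronoi _ gq0).
apply/(mem_voronoi _ gq0)/(nearest_lconj x y q0); first exact: voronoi_reduced hw'.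
exact/(mem_voronoi _ q0).
Qed.

Definition fraction A q : R := (count A (voronoi q))%:R / (size (voronoi q))%:R.

Lemma fraction_ge0 A q : 0 <= fraction A q.
Proof. by rewrite divr_ge0. Qed.

Lemma fraction_le1 A q : fraction A q <= 1.
Proof.
have := count_size A (voronoi q); rewrite /fraction.
case: (size _) => [|k] h; first by rewrite invr0 mulr0.
by rewrite ler_pdivrMr // mul1r ler_nat.
Qed.

Lemma fraction_lconj x y q : y != x -> y != linv x -> 0 < q.2 ->
  fraction (head2_is x y) (mob_act (cgen xi x y) q) = 1 - fraction (head2_is x (linv y)) q.
Proof.
move=> yx yx' q0; rewrite /fraction (permP (voronoi_lconj x y q0)).
rewrite (perm_size (voronoi_lconj x y q0)) size_map count_map.
have s0 : (size (voronoi q))%:R != 0 :> R by rewrite pnatr_eq0 -lt0n voronoi_size_gt0.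
rewrite (eq_in_count (a2 := predC (head2_is x (linv y)))); last first.
  by move=> w /(voronoi_reduced q0) rw /=; rewrite head2_lconj.
rewrite -(count_predC (head2_is x (linv y)) (voronoi q)) natrD.
have := s0; rewrite -{1}(count_predC (head2_is x (linv y)) (voronoi q)) natrD => s1.
by field.
Qed.

(** Distinct prefixes select disjoint sets of words, so each word is counted for at most one
    index. *)
Lemma fraction_sum_le1 (I : finType) (P : pred I) (u : I -> seq ('I_n * bool)) q :
  {in P &, injective u} ->
  \sum_(k | P k) fraction (fun w => take 2 w == u k) q <= 1.
Proof.
move=> inj_u; rewrite /fraction -mulr_suml.
have : (\sum_(k | P k) count (fun w => take 2 w == u k) (voronoi q) <= size (voronoi q))%N.
  under eq_bigr do rewrite -sum1_count big_mkcond /=.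
  rewrite exchange_big /= -sum1_size; apply: leq_sum => w _.
  case: (pickP (fun k => P k && (take 2 w == u k))) => [k /andP[Pk /eqP E]|h].
    rewrite (bigD1 k) //= E eqxx big1 // => l /andP[Pl lk].
    by case: eqP => // /(inj_u _ _ Pk Pl) kl; rewrite kl eqxx in lk.
  by rewrite big1 // => k Pk; have := h k; rewrite Pk /= => ->.
rewrite -(ler_nat R) natr_sum; case: (size _) => [|k] h; first by rewrite invr0 mulr0.
by rewrite ler_pdivrMr // mul1r.
Qed.

(** Enumerating the competitors by [pickle] gives a countable intersection of inequalities between
    measurable functions; codes of no reduced word contribute the whole space. *)
Lemma measurable_nearest w : measurable [set z : RM * RM * RM | nearest (hpt z) w].
Proof.
case: (boolP (reduced w)) => rw; last first.
  rewrite (_ : [set _ | _] = set0) //.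
  by apply/seteqP; split => // z [h _]; rewrite h in rw.
have mH u : measurable_fun setT (fun z : RM * RM * RM => orbit_cosh u (hpt z)).
  exact: measurable_hcosh.
pose E k : set (RM * RM * RM) := if pickle_inv k is Some w' then
  if reduced w' then [set z | orbit_cosh w (hpt z) <= 1 + orbit_cosh w' (hpt z)] else setT
  else setT.
rewrite (_ : [set _ | _] = \bigcap_k E k).
  apply: bigcapT_measurable => k; rewrite /E; case: pickle_inv => // w'.
  case: ifP => // _; rewrite -[X in measurable X]setTI.
  have := @measurable_fun_ler _ _ R setT (fun z => orbit_cosh w (hpt z))
    (fun z => 1 + orbit_cosh w' (hpt z)) (mH w).
  have m1 : measurable_fun setT (fun z : RM * RM * RM => 1 + orbit_cosh w' (hpt z)).
    by apply: measurable_funD; [exact: measurable_cst|exact: mH].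
  by move=> /(_ m1) /(_ measurableT [set true]) /(_ I).
apply/seteqP; split => z.
  move=> [_ h] k _; rewrite /E; case: pickle_inv => // w'; case: ifP => // rw' /=.
  exact: h.
move=> h; split => // w' rw'; have := h (choice.pickle w') I.
by rewrite /E pickleK_inv rw'.
Qed.

(** A count over the almost nearest words is the limit of sums of indicators over the words of code
    below N. At each point these sums are eventually constant, since only finitely many words are
    almost nearest there. *)
Lemma hmeasurable_fraction A : hmeasurable (fraction A).
Proof.
have mc B : measurable_fun setT (fun z : RM * RM * RM => (count B (voronoi (hpt z)))%:R : R).
  pose us N : seq (seq ('I_n * bool)) := pmap pickle_inv (iota 0 N).
  apply: (@measurable_fun_cvg _ _ R setT (fun N z =>
    \sum_(w <- us N) (\1_[set z | nearest (hpt z) w] z * (B w)%:R : R))).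
    move=> N; apply: measurable_sum => w; apply: measurable_funM; last exact: measurable_cst.
    exact: measurable_indic (measurable_nearest w).
  move=> z _; apply: cvg_near_cst.
  pose N0 := (\max_(w <- voronoi (hpt z)) choice.pickle w).+1.
  exists N0 => // N /= hN.
  have z0 := @hpt_gt0 R z.
  rewrite (_ : count B _ = count B [seq w <- us N | w \in voronoi (hpt z)]); last first.
    apply/permP; apply: uniq_perm; rewrite ?uniq_voronoi //.
      apply: filter_uniq; apply: pmap_uniq (iota_uniq _ _); exact: pickle_invK.
    move=> w; rewrite mem_filter /=; case: (boolP (w \in voronoi _)) => //= hw.
    rewrite mem_pmap; apply/esym/mapP; exists (choice.pickle w); last by rewrite pickleK_inv.
    rewrite mem_iota /= add0n (leq_trans _ hN) // ltnS.
    by rewrite (@leq_bigmax_seq _ _ _ (fun w => choice.pickle w)).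
  rewrite count_filter -sum1_count natr_sum [RHS]big_mkcond /=; apply: eq_bigr => w _.
  rewrite indicE; have -> : (z \in [set z | nearest (hpt z) w]) = (w \in voronoi (hpt z)).
    by apply/idP/idP => [/set_mem /(mem_voronoi _ z0)|/(mem_voronoi _ z0) h] //; exact/mem_set.
  by case: (B w); case: (_ \in _); rewrite ?mulr1 ?mulr0.
rewrite /hmeasurable; apply: measurable_funM; first exact: mc.
have mV : measurable_fun setT (fun z : RM * RM * RM => (size (voronoi (hpt z)))%:R : R).
  by under eq_fun do rewrite -count_predT; exact: mc.
rewrite (_ : (fun z => _) = (@powR R ^~ (-1)) \o (fun z : RM * RM * RM => (size (voronoi (hpt z)))%:R)).
  by apply: measurableT_comp mV; exact: measurable_powR.
by apply/funext => z; rewrite /= powR_inv1.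
Qed.
End Voronoi.

(** * The polynomial *)

Ltac nonneg m0 := do ?[exact: m0 | exact: ler0n | apply: addr_ge0 |
  apply: mulr_ge0 | apply: exprn_ge0].

(* 4n(n-1) - 1 is the lower bound obtained for e^d, so no root of P exceeds e^(2d).
   Coefficients are written in base 100 because large numerals are unary. *)
Lemma calP_gt0 (R : realType) (n : nat) (l : R) : (2 <= n)%N ->
  (4 * n%:R * (n%:R - 1) - 1) ^+ 2 <= l -> 0 < calP n l.
Proof.
(* With n = m + 2 the polynomials to be compared with 0 acquire nonnegative coefficients in m. *)
case: n => [|[|m]] // _; rewrite -[m.+2]addn2 natrD /calP natrD.
have := ler0n R m; move: (m%:R : R) => {}m m0.
set n := m + 2%:R => hl.
set A := 8 * n ^+ 3 - 12 * n ^+ 2 + 2 * n + 1.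
set c3 := - 64 * n ^+ 6 + _ - _ + _ + _ + _ - _.
set c2 := - 96 * n ^+ 5 + _ - _ + _ - _ + _.
set c1 := 32 * n ^+ 5 - _ + _ - _ + _ - _.
set c0 := 16 * n ^+ 4 - _ + _ - _ + _.
have l2 : 2 <= l.
  apply: le_trans hl; rewrite (_ : 4 * n * (n - 1) - 1 = 4 * m ^+ 2 + 12 * m + 7).
    by nra.
  by rewrite /n; ring.
have A0 : 0 <= A.
  rewrite (_ : A = 8 * m ^+ 3 + 36 * m ^+ 2 + 50 * m + 21); last by rewrite /A /n; ring.
  by nonneg m0.
(* The coefficient of l^3 once A l^4 is bounded below by A (4n(n-1) - 1)^2 l^3. The weak bound l >=
   2 is then enough to absorb [c2]. *)
pose X := A * (4 * n * (n - 1) - 1) ^+ 2 + c3.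
have XE : X = (1 * 10 ^+ 2 + 28) * m ^+ 7 + (12 * 10 ^+ 2 + 80) * m ^+ 6
      + (52 * 10 ^+ 2 + 80) * m ^+ 5 + (115 * 10 ^+ 2 + 68) * m ^+ 4
    + (144 * 10 ^+ 2 + 24) * m ^+ 3 + (101 * 10 ^+ 2 + 44) * m ^+ 2
      + (36 * 10 ^+ 2 + 92) * m + (5 * 10 ^+ 2 + 33).
  by rewrite /X /A /c3 /n; ring.
have X0 : 0 <= X by rewrite XE; nonneg m0.
have X2 : 0 <= 2 * X + c2.
  rewrite (_ : _ + c2 = (2 * 10 ^+ 2 + 56) * m ^+ 7 + (25 * 10 ^+ 2 + 60) * m ^+ 6
      + (104 * 10 ^+ 2 + 64) * m ^+ 5 + 224 * 10 ^+ 2 * m ^+ 4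
    + (266 * 10 ^+ 2 + 32) * m ^+ 3 + (170 * 10 ^+ 2 + 28) * m ^+ 2
      + (50 * 10 ^+ 2 + 46) * m + (4 * 10 ^+ 2 + 12)); first by nonneg m0.
  by rewrite XE /c2 /n; ring.
have c10 : 0 <= c1.
  rewrite (_ : c1 = 32 * m ^+ 5 + (2 * 10 ^+ 2 + 8) * m ^+ 4 + (5 * 10 ^+ 2 + 12) * m ^+ 3
      + (5 * 10 ^+ 2 + 72) * m ^+ 2
    + (2 * 10 ^+ 2 + 62) * m + 24); last by rewrite /c1 /n; ring.
  by nonneg m0.
have c00 : 0 < c0.
  rewrite (_ : c0 = (2 * m + 3) ^+ 4); last by rewrite /c0 /n; ring.
  by rewrite exprn_gt0 //; lra.
have l0 : 0 <= l by lra.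
have ? : 0 <= c1 * l by exact: mulr_ge0.
have ? : 0 <= l ^+ 3 * (A * (l - (4 * n * (n - 1) - 1) ^+ 2)).
  by rewrite mulr_ge0 ?exprn_ge0 // mulr_ge0 // subr_ge0.
have ? : 0 <= l ^+ 2 * (X * (l - 2) + (2 * X + c2)).
  by rewrite mulr_ge0 ?exprn_ge0 // addr_ge0 // mulr_ge0 // subr_ge0.
rewrite (_ : _ + c0 = l ^+ 3 * (A * (l - (4 * n * (n - 1) - 1) ^+ 2))
   + l ^+ 2 * (X * (l - 2) + (2 * X + c2)) + c1 * l + c0); last by rewrite /X; ring.
by rewrite ltr_wpDl // !addr_ge0.
Qed.

(** * Displacements of the conjugates *)

Section HyperbolicIntegral.
Context {R : realType}.
Implicit Types F G : R[i] * R -> R.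

Let EFin_hpt_ge0 F : (forall p, 0 <= F p) ->
  forall x, setT x -> (0 <= (F (hpt x))%:E)%E.
Proof. by move=> F0 x _; rewrite lee_fin; exact: F0. Qed.

Lemma hintegral_le F G : hmeasurable F -> hmeasurable G -> (forall p, 0 <= F p) ->
  (forall q, 0 < q.2 -> F q <= G q) -> (hintegral F <= hintegral G)%E.
Proof.
move=> mF mG F0 FG; apply: ge0_le_integral.
- exact: measurableT.
- exact: EFin_hpt_ge0.
- exact/measurable_EFinP.
- exact/measurable_EFinP.
- by move=> x _; rewrite lee_fin; apply: FG; exact: hpt_gt0.
Qed.

Lemma hintegral_eq F G : (forall q, 0 < q.2 -> F q = G q) -> hintegral F = hintegral G.
Proof. by move=> FG; apply: eq_integral => x _; rewrite FG // hpt_gt0. Qed.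

Lemma hintegralD F G : hmeasurable F -> hmeasurable G -> (forall p, 0 <= F p) -> (forall p, 0 <= G p) ->
  hintegral (fun q => F q + G q) = (hintegral F + hintegral G)%E.
Proof.
move=> mF mG F0 G0; rewrite /hintegral; under eq_integral do rewrite EFinD.
apply: ge0_integralD.
- exact: measurableT.
- exact: EFin_hpt_ge0.
- exact/measurable_EFinP.
- exact: EFin_hpt_ge0.
- exact/measurable_EFinP.
Qed.

Lemma hintegral_sum (I : finType) (P : pred I) (F : I -> R[i] * R -> R) :
  (forall k, hmeasurable (F k)) -> (forall k p, 0 <= F k p) ->
  hintegral (fun q => \sum_(k | P k) F k q) = (\sum_(k | P k) hintegral (F k))%E.
Proof.
move=> mF F0; rewrite /hintegral; under eq_integral do rewrite -sumEFin.
rewrite -big_filter; under eq_integral do rewrite -big_filter.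
apply: ge0_integral_sum.
- exact: measurableT.
- by move=> k; apply/measurable_EFinP; exact: mF.
- by move=> k x _; rewrite lee_fin; exact: F0.
Qed.

Lemma hmeasurableM F G : hmeasurable F -> hmeasurable G -> hmeasurable (fun q => F q * G q).
Proof. exact: measurable_funM. Qed.

Lemma hmeasurable_sum (I : finType) (P : pred I) (F : I -> R[i] * R -> R) :
  (forall k, hmeasurable (F k)) -> hmeasurable (fun q => \sum_(k | P k) F k q).
Proof.
move=> mF; rewrite /hmeasurable /comp; under eq_fun do rewrite -big_filter.
by apply: measurable_sum => k; exact: mF.
Qed.

(** An isometry carries p and q to (0, 1) and (0, T) and preserves both the volume and the kernels;
    the bound on the distance becomes T <= T1. *)
Lemma hintegral_min_hkernel (s theta Z T1 : R) (p q : R[i] * R) :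
  (forall T, 1 <= T <= T1 ->
    ((theta * Z)%:E <= hintegral (fun x => Num.min (hkernel s (0, 1) x) (hkernel s (0, T) x))%R)%E) ->
  0 < p.2 -> 0 < q.2 -> hdist p q <= ln T1 -> 1 <= T1 ->
  ((theta * Z)%:E <= hintegral (fun x => Num.min (hkernel s p x) (hkernel s q x))%R)%E.
Proof.
move=> h p0 q0 dT T11; have [g [T [g1 T0 gp gq]]] := pair_to_axis p0 q0.
have T00 : 0 < T by exact: lt_le_trans ltr01 T0.
have T10 : 0 < T1 by exact: lt_le_trans ltr01 T11.
have TE : hcosh p q = (T + T^-1) / 2.
  by rewrite -(hcosh_mob_act g1 p0 q0) gp gq hcosh_axis.
have TT1 : 1 <= T <= T1.
  by rewrite T0 /= -ler_ln ?posrE // -(hdist_axis T0 TE).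
apply: le_trans (h T TT1) _; pose F x := Num.min (hkernel s (0, 1) x) (hkernel s (0, T) x).
have mF : hmeasurable F by apply: measurable_minr; exact: hmeasurable_hkernel.
have F0 x : 0 <= F x by rewrite le_min !hkernel_ge0.
have [_ /(_ F0) <-] := hintegral_mob_act g1 mF.
rewrite (hintegral_eq (G := fun x => Num.min (hkernel s p x) (hkernel s q x))) // => x x0.
by rewrite /F /hkernel /= -gp -gq !hcosh_mob_act.
Qed.

Lemma hintegral_hkernel_base (s : R) (p : R[i] * R) : 0 < p.2 ->
  hintegral (hkernel s p) = hintegral (hkernel s (0, 1)).
Proof.
move=> p0; have [g [g1 gp]] := base_transitive p0.
have [_ /(_ (hkernel_ge0 s _)) <-] := hintegral_mob_act g1 (hmeasurable_hkernel s (0, 1)).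
by apply: hintegral_eq => x x0; rewrite /hkernel /= -gp hcosh_mob_act.
Qed.

End HyperbolicIntegral.

Section Displacement.
Variables (R : realType) (n : nat) (xi : 'I_n -> 'M[R[i]]_2).
Hypothesis det_xi : forall i, \det (xi i) = 1.
Hypothesis free_xi : freely_generating xi.
Hypothesis kleinian_xi : kleinian xi.
Variable p : R[i] * R.
Hypothesis p_gt0 : 0 < p.2.

Local Notation fraction := (fraction xi p).

Lemma disp_min_overlap (s : R) (x y : 'I_n * bool) : y != x -> y != linv x ->
  exists q, [/\ 0 < q.2, hdist p q = disp (cgen xi x y) p &
   (hintegral (fun z => Num.min (hkernel s p z) (hkernel s q z))%R <=
    hintegral (fun z => fraction (head2_is x y) z * hkernel s p z)%R +
    hintegral (fun z => fraction (head2_is x (linv y)) z * hkernel s p z)%R)%E].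
Proof.
move=> yx yx'; set g := cgen xi x y.
have g1 : \det g = 1 by exact: det_cgen.
have gi1 : \det (invmx g) = 1 by rewrite det_inv g1 invr1.
pose q := mob_act (invmx g) p.
have q0 : 0 < q.2 by exact: mob_act_gt0.
have gq : mob_act g q = p.
  by rewrite /q -mob_actM // -[g * _]/(g *m _) mulmxV ?mob_act1 // unitmxE g1 unitr1.
have hq : hcosh p q = hcosh p (mob_act g p).
  by rewrite -(hcosh_mob_act g1 p_gt0 q0) gq hcoshC.
exists q; split => //; first by rewrite /disp /hdist hq.
have mK : hmeasurable (hkernel s p) := hmeasurable_hkernel s p.
have mq : hmeasurable (hkernel s q) := hmeasurable_hkernel s q.
pose phi := fraction (head2_is x (linv y)).
have mphi : hmeasurable phi by exact: hmeasurable_fraction.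
have phi0 z : 0 <= 1 - phi z by rewrite subr_ge0 fraction_le1.
have m1 : hmeasurable (fun z => 1 - phi z).
  by apply: measurable_funB => //; exact: measurable_cst.
(* The substitution z |-> g z: the fraction becomes 1 - phi and, as g q = p, the kernel at p becomes
   the kernel at q. *)
have -> : hintegral (fun z => fraction (head2_is x y) z * hkernel s p z)
    = hintegral (fun z => (1 - phi z) * hkernel s q z).
  have mA : hmeasurable (fun z => fraction (head2_is x y) z * hkernel s p z).
    by apply: hmeasurableM => //; exact: hmeasurable_fraction.
  have A0 z : 0 <= fraction (head2_is x y) z * hkernel s p z.
    by rewrite mulr_ge0 ?fraction_ge0 ?hkernel_ge0.
  have [_ /(_ A0) <-] := hintegral_mob_act g1 mA.
  apply: hintegral_eq => z z0 /=; rewrite fraction_lconj //; congr (_ * _).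
  by rewrite /hkernel -gq hcosh_mob_act.
rewrite -hintegralD; last 4 first.
- exact: hmeasurableM.
- exact: hmeasurableM.
- by move=> z; rewrite mulr_ge0 ?hkernel_ge0.
- by move=> z; rewrite mulr_ge0 ?fraction_ge0 ?hkernel_ge0.
apply: hintegral_le.
- exact: measurable_minr.
- exact: measurable_funD (hmeasurableM m1 mq) (hmeasurableM mphi mK).
- by move=> z; rewrite le_min !hkernel_ge0.
move=> z z0; rewrite -/(phi z); have p0 := fraction_ge0 xi p (head2_is x (linv y)) z.
rewrite -/(phi z) in p0.
have hm1 : Num.min (hkernel s p z) (hkernel s q z) <= hkernel s p z by rewrite ge_min lexx.
have hm2 : Num.min (hkernel s p z) (hkernel s q z) <= hkernel s q z by rewrite ge_min lexx orbT.
have := ler_wpM2l (phi0 z) hm2; have := ler_wpM2l p0 hm1; lra.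
Qed.

(* The 4n(n-1) sets of words starting with x y, for y not a power of x, are disjoint;
   paired as {x y, x y^-1} each pair carries at least the overlap 2 / (1 + e^d). *)
Lemma exists_large_disp (T1 : R) : 1 <= T1 -> T1 < (4 * n * (n - 1))%:R - 1 ->
  exists (x : 'I_n * bool) (j : 'I_n), j != x.1 /\ ln T1 < disp (cgen xi x (j, true)) p.
Proof.
move=> T11 T1n; apply: contrapT => H.
have small (x : 'I_n * bool) (j : 'I_n) : j != x.1 -> disp (cgen xi x (j, true)) p <= ln T1.
  by move=> jx; rewrite leNgt; apply/negP => h; apply: H; exists x, j.
pose N : R := (2 * n * (n - 1))%:R.
have NE : (4 * n * (n - 1))%:R = 2 * N :> R by rewrite /N -natrM !mulnA.
have N0 : 0 < N by lra.
(* The midpoint: above 1/N, so that N pairs exceed the total mass, and below the limiting overlap,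
   so that some kernel attains it. *)
pose theta := (N^-1 + 2 / (1 + T1)) / 2.
have T1N : N^-1 < 2 / (1 + T1).
  by rewrite -div1r ltr_pdivrMr // mulrAC ltr_pdivlMr; lra.
have Ni0 : 0 < N^-1 by rewrite invr_gt0.
have th0 : 0 <= theta by rewrite /theta; lra.
have thT : theta < 2 / (1 + T1) by rewrite /theta; lra.
have thN : 1 < theta * N.
  by rewrite -ltr_pdivrMr // div1r /theta; lra.
have [s [Z [Z0 hZ hov]]] := hkernel_overlap T11 th0 thT.
pose K := hkernel s p.
have mK : hmeasurable K by exact: hmeasurable_hkernel.
(* An index k = (x, j) names a pair of sets; the sign of the second letter picks one set of the
   pair. *)
pose P (k : ('I_n * bool) * 'I_n) := k.2 != k.1.1.
pose F (k : ('I_n * bool) * 'I_n) (b : bool) q := fraction (head2_is k.1 (k.2, b)) q * K q.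
have mF k b : hmeasurable (F k b).
  by apply: hmeasurableM => //; exact: hmeasurable_fraction.
have F0 k b q : 0 <= F k b q by rewrite mulr_ge0 ?fraction_ge0 ?hkernel_ge0.
have pair_ge k : P k -> ((theta * Z)%:E <= hintegral (F k true) + hintegral (F k false))%E.
  case: k => x j /= jx; rewrite /P /= in jx.
  have y1 : (j, true) != x by case: x jx => i b /=; apply: contra => /eqP[->].
  have y2 : (j, true) != linv x by case: x jx {y1} => i b /=; apply: contra => /eqP[->].
  have [q [q0 dq ov]] := disp_min_overlap s y1 y2.
  apply: le_trans ov; apply: hintegral_min_hkernel hov p_gt0 q0 _ T11.
  by rewrite dq small.
pose Q (k : (('I_n * bool) * 'I_n) * bool) := P k.1.
have sum_le : (\sum_(k | Q k) hintegral (F k.1 k.2) <= hintegral K)%E.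
  rewrite -hintegral_sum //; apply: hintegral_le.
  - by apply: hmeasurable_sum => k; exact: mF.
  - exact: mK.
  - by move=> q; apply: sumr_ge0.
  - move=> q q0; rewrite -mulr_suml ler_piMl ?hkernel_ge0 //.
    apply: (@fraction_sum_le1 _ _ xi p _ Q (fun k => [:: k.1.1; (k.1.2, k.2)])).
    by move=> [[x j] b] [[x' j'] b'] _ _ /= [-> -> ->].
have card_P : (\sum_(k | P k) 1 = 2 * n * (n - 1))%N.
  rewrite -(pair_big_dep xpredT (fun (x : 'I_n * bool) j => j != x.1) (fun _ _ => 1%N)) /=.
  under eq_bigr do rewrite sum1_card cardC1 card_ord.
  by rewrite sum_nat_const card_prod card_ord card_bool subn1 (mulnC n).
have : (\sum_(k | P k) (theta * Z)%:E <= Z%:E)%E.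
  apply: le_trans hZ; rewrite -(hintegral_hkernel_base s p_gt0).
  apply: le_trans sum_le.
  rewrite (_ : (\sum_(k | Q k) hintegral (F k.1 k.2) = \sum_(k | P k) \sum_(b : bool) hintegral (F k b))%E).
    by apply: lee_sum => k Pk; rewrite big_bool; exact: pair_ge.
  by rewrite pair_big /=; apply: eq_bigl => k; rewrite andbT.
rewrite sumEFin lee_fin (eq_bigr (fun=> theta * Z * 1%:R)); last by move=> k _; rewrite mulr1.
rewrite -mulr_sumr -natr_sum card_P -/N.
have : 1 * Z < theta * N * Z by rewrite ltr_pM2r.
by rewrite mul1r mulrAC => h1 h2; have := lt_le_trans h1 h2; rewrite ltxx.
Qed.
End Displacement.

Theorem theorem6p3 (R : realType) (n : nat) (xi : 'I_n -> 'M[R[i]]_2) :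
  (2 <= n)%N ->
  (forall i, \det (xi i) = 1) ->
  freely_generating xi ->
  kleinian xi ->
  purely_loxodromic xi ->
  forall alpha : R, ((2 * n - 1) ^ 2)%:R < alpha -> calP n alpha = 0 ->
  forall (z : R[i]) (t : R), 0 < t ->
  exists g, in_Gamma_star xi g /\ ln alpha / 2 <= disp g (z, t).
Proof.
move=> n2 det_xi free_xi kl _ alpha alpha_gt alpha_root z t t0.
have al1 : 1 <= alpha.
  apply: le_trans (ltW alpha_gt); rewrite -[1]/(1%:R) ler_nat expn_gt0.
  by rewrite subn_gt0 (leq_trans n2) // leq_pmull.
have NE : (4 * n * (n - 1))%:R - 1 = 4 * n%:R * (n%:R - 1) - 1 :> R.
  by rewrite natrM natrB ?(ltnW n2) // natrM.
pose N : R := (4 * n * (n - 1))%:R - 1.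
have N1 : 0 <= N.
  rewrite subr_ge0 -[1]/(1%:R) ler_nat muln_gt0 subn_gt0 n2 andbT muln_gt0.
  exact: ltnW.
have al0 : 0 <= alpha by lra.
(* Otherwise alpha would lie in the range where the polynomial is positive. Hence T1 can be taken to
   be the square root of alpha, whose logarithm is the required bound. *)
have alN : Num.sqrt alpha < N.
  rewrite ltNge; apply/negP => h.
  have : N ^+ 2 <= alpha by rewrite -[leRHS]sqr_sqrtr // lerXn2r ?nnegrE ?sqrtr_ge0.
  by rewrite /N NE => /(calP_gt0 n2); rewrite alpha_root ltxx.
have sq1 : 1 <= Num.sqrt alpha by rewrite -[leLHS]sqrtr1 ler_sqrt.
have [x [j [jx hd]]] := exists_large_disp det_xi free_xi kl (p := (z, t)) t0 sq1 alN.
exists (cgen xi x (j, true)); split.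
  by right; right; exists x.1, j, x.2, true; split; first by rewrite eq_sym.
by move: hd; rewrite -powR12_sqrt // ln_powR mulrC => /ltW.
Qed.
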